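(* Consider the $q$-state $p$-adic Potts model on the Cayley tree of order $k=3$, let $\theta=1-q$ and let $m\in\{1,\dots,q-1\}$. Then $|\mathcal G(H)|\ge 1+\binom{q}{m}$ if one of the following conditions is satisfied: a) $p=2$ and $|q|_2<|2m|_2$; b) $p\ne2$ and $|q|_p<|m|_p$; c) $p\neq2$, $|q|_p=|m|_p$ and $x^2+x+1\equiv0\pmod p$, where $x=1-q/m$.
   Context: $p$ is a prime, $\mathbb Q_p$ the field of $p$-adic numbers with norm $|\cdot|_p$. Cayley tree: $\Gamma^k=(V,L)$ is the infinite tree in which every vertex has exactly $k+1$ neighbours; $x^0\in V$ is a fixed root, $d$ the graph distance, $W_n=\{x\in V:d(x,x^0)=n\}$, $V_n=\bigcup_{j=0}^nW_j$. Potts model: spins take values in $\Phi=\{1,\dots,q\}$, $q\ge2$; the Hamiltonian is $H(\sigma)=J\sum_{\langle x,y\rangle\in L}\delta_{\sigma(x)\sigma(y)}$ with $J\in\mathbb Q_p$, $|J|_p<p^{-1/(p-1)}$, and $\theta=\exp_p(J)$. $H_n$ is the restriction of $H$ to $V_n$. $p$-adic Gibbs measure: a $p$-adic measure is a finitely additive $\mathbb Q_p$-valued function on an algebra of sets; it is a probability measure if the total mass is $1$. Given vectors $\tilde h_x=(\tilde h_{1,x},\dots,\tilde h_{q,x})\in\mathbb Q_p^q$, $x\in V$ (with entries in the domain of convergence of $\exp_p$), put $$\mu^{(n)}_{\tilde h}(\sigma_n)=Z_{n,\tilde h}^{-1}\exp_p\Big\{H_n(\sigma_n)+\sum_{x\in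 W_n}\tilde h_{\sigma_n(x),x}\Big\},\qquad \sigma_n\in\Phi^{V_n},$$ where $Z_{n,\tilde h}$ is the (nonzero) normalizing factor. If these are compatible, i.e. $\sum_{\omega_n\in\Phi^{W_n}}\mu^{(n)}_{\tilde h}(\sigma_{n-1}\vee\omega_n)=\mu^{(n-1)}_{\tilde h}(\sigma_{n-1})$ for all $n\ge1$ and $\sigma_{n-1}\in\Phi^{V_{n-1}}$ ($\vee$ is concatenation), they define a unique $p$-adic probability measure $\mu_{\tilde h}$ on the algebra of cylinder sets of $\Phi^V$, called a $p$-adic Gibbs measure. $\mathcal G(H)$ is the set of all $p$-adic Gibbs measures obtained in this way. *)

(* Defs.v *)
From HB Require Import structures.
From mathcomp Require Import all_boot all_order all_algebra finmap.
From mathcomp Require Import generic_quotient ring_quotient.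
From mathcomp Require Import all_classical all_reals.
From mathcomp Require Import topology normedtype sequences exp.

Set Implicit Arguments.
Unset Strict Implicit.
Unset Printing Implicit Defensive.

Import Order.TTheory GRing.Theory Num.Theory.
Import numFieldNormedType.Exports.

Local Open Scope quotient_scope.
Local Open Scope classical_set_scope.
Local Open Scope ring_scope.

Section RatPadicAbs.
Variable p : nat.

Definition padic_val (x : rat) : int :=
  (logn p `|numq x|)%:Z - (logn p `|denq x|)%:Z.

Definition padic_abs (x : rat) : rat :=
  if x == 0 then 0 else p%:Q ^ (- padic_val x).

Definition cauchy_seq : {pred nat -> rat} := fun u => `[<
  forall e : rat, 0 < e ->
  exists N, forall i j, (N <= i)%N -> (N <= j)%N -> padic_abs (u i - u j) < e >].

Hypothesis p_pr : prime p.

Let p_gt0 : 0 < p%:Q.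
Proof. by rewrite ltr0n prime_gt0. Qed.

Lemma padic_abs0 : padic_abs 0 = 0.
Proof. by rewrite /padic_abs eqxx. Qed.

Lemma padic_abs_ge0 x : 0 <= padic_abs x.
Proof. by rewrite /padic_abs; case: eqP => // _; rewrite exprz_ge0. Qed.

Lemma padic_abs_gt0 x : x != 0 -> 0 < padic_abs x.
Proof. by move=> x0; rewrite /padic_abs (negPf x0) exprz_gt0. Qed.

Let absz_gt0 (a : int) : a != 0 -> (0 < `|a|)%N.
Proof. by rewrite absz_gt0. Qed.

Lemma padic_val_frac (a b : int) : a != 0 -> b != 0 ->
  padic_val (a%:Q / b%:Q) = (logn p `|a|)%:Z - (logn p `|b|)%:Z.
Proof.
move=> a0 b0; set x := a%:Q / b%:Q.
have x0 : x != 0 by rewrite mulf_neq0 ?invr_eq0 ?intr_eq0.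
have E : numq x * b = a * denq x.
  apply: (@intr_inj rat); rewrite !rmorphM /= numqE /x mulrAC.
  by rewrite divfK // intr_eq0.
have := congr1 (fun z : int => logn p `|z|) E.
rewrite !abszM !lognM ?absz_gt0 ?numq_eq0 ?denq_eq0 // => {}E.
apply/eqP; rewrite /padic_val subr_eq addrAC eq_sym subr_eq eq_sym.
by rewrite -!PoszD E.
Qed.

Lemma padic_valM x y : x != 0 -> y != 0 ->
  padic_val (x * y) = padic_val x + padic_val y.
Proof.
move=> x0 y0; rewrite -[x in LHS]divq_num_den -[y in LHS]divq_num_den.
rewrite mulf_div -!intrM padic_val_frac ?mulf_neq0 ?numq_eq0 ?denq_eq0 //.
rewrite !abszM !lognM ?absz_gt0 ?numq_eq0 ?denq_eq0 // !PoszD /padic_val.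
by rewrite opprD addrACA.
Qed.

Lemma padic_absM x y : padic_abs (x * y) = padic_abs x * padic_abs y.
Proof.
have [->|x0] := eqVneq x 0; first by rewrite mul0r padic_abs0 mul0r.
have [->|y0] := eqVneq y 0; first by rewrite mulr0 padic_abs0 mulr0.
rewrite /padic_abs mulf_eq0 (negPf x0) (negPf y0) /= padic_valM // opprD.
by rewrite expfzDr ?gt_eqF.
Qed.

Lemma padic_abs1 : padic_abs 1 = 1.
Proof.
by rewrite /padic_abs oner_eq0 /padic_val -[1]/(1%:Q) numq_int denq_int subrr.
Qed.

Lemma padic_absN x : padic_abs (- x) = padic_abs x.
Proof. by rewrite /padic_abs oppr_eq0 /padic_val numqN denqN abszN. Qed.

Lemma padic_absV (x : rat) : padic_abs x^-1 = (padic_abs x)^-1.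
Proof.
have [->|x0] := eqVneq x 0; first by rewrite invr0 padic_abs0.
have a0 : padic_abs x != 0 by rewrite gt_eqF ?padic_abs_gt0.
by apply: (mulfI a0); rewrite -padic_absM !divff // padic_abs1.
Qed.

Lemma padic_absD x y :
  padic_abs (x + y) <= Num.max (padic_abs x) (padic_abs y).
Proof.
have [->|x0] := eqVneq x 0; first by rewrite add0r le_max lexx orbT.
have [->|y0] := eqVneq y 0; first by rewrite addr0 le_max lexx.
have [->|s0] := eqVneq (x + y) 0.
  by rewrite padic_abs0 le_max padic_abs_ge0.
set a := numq x * denq y; set b := numq y * denq x; set d := denq x * denq y.
have d0 : d != 0 by rewrite mulf_neq0 ?denq_eq0.
have a0 : a != 0 by rewrite mulf_neq0 ?denq_eq0 ?numq_eq0.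
have b0 : b != 0 by rewrite mulf_neq0 ?denq_eq0 ?numq_eq0.
have dxQ : (denq x)%:Q != 0 by rewrite intr_eq0 denq_eq0.
have dyQ : (denq y)%:Q != 0 by rewrite intr_eq0 denq_eq0.
have Ex : x = a%:Q / d%:Q.
  by rewrite !intrM -mulf_div divff // mulr1 divq_num_den.
have Ey : y = b%:Q / d%:Q.
  by rewrite !intrM [X in _ / X]mulrC -mulf_div divff // mulr1 divq_num_den.
have Es : x + y = (a + b)%:Q / d%:Q by rewrite {1}Ex {1}Ey -mulrDl -intrD.
have ab0 : a + b != 0.
  by apply: contraNneq s0; rewrite Es => ->; rewrite mul0r.
rewrite /padic_abs (negPf x0) (negPf y0) (negPf s0).
rewrite Es Ex Ey !padic_val_frac // le_max.
have p_gt1 : 1 < p%:Q by rewrite ltr1n prime_gt1.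
rewrite !ler_eXz2l // !lerN2 !lerD2r !lez_nat.
wlog lab : a b a0 b0 ab0 {Ex Ey Es} / (logn p `|a| <= logn p `|b|)%N.
  move=> H; have /orP[lab|lab] := leq_total (logn p `|a|) (logn p `|b|).
    exact: H.
  by rewrite orbC addrC; apply: H => //; rewrite addrC.
apply/orP; left; rewrite -pfactor_dvdn ?absz_gt0 //.
change (((p ^ logn p `|a|)%N%:Z %| (a + b)%R)%Z).
by apply: rpredD; rewrite dvdzE absz_nat pfactor_dvdn ?absz_gt0.
Qed.

Lemma padic_absB x y :
  padic_abs (x - y) <= Num.max (padic_abs x) (padic_abs y).
Proof. by rewrite -(padic_absN y) padic_absD. Qed.

Lemma padic_distC x y : padic_abs (x - y) = padic_abs (y - x).
Proof. by rewrite -opprB padic_absN. Qed.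

Lemma cauchy_seq_bounded u : u \in cauchy_seq ->
  exists2 M, 0 < M & forall n, padic_abs (u n) <= M.
Proof.
move=> /asboolP /(_ 1 ltr01) [N uN].
exists (1 + \sum_(i < N.+1) padic_abs (u i)).
  by rewrite ltr_pwDl ?sumr_ge0 // => i _; apply: padic_abs_ge0.
move=> n.
have leS k : (k <= N)%N ->
    padic_abs (u k) <= 1 + \sum_(i < N.+1) padic_abs (u i).
  move=> kN; rewrite (bigD1 (inord k)) //= inordK ?ltnS // addrCA lerDl.
  by rewrite addr_ge0 ?sumr_ge0 // => i _; apply: padic_abs_ge0.
have [/leS //|/ltnW Nn] := leqP n N.
rewrite -(subrK (u N) (u n)) (le_trans (padic_absD _ _)) // ge_max leS // andbT.
rewrite (le_trans (ltW (uN _ _ Nn (leqnn N)))) // lerDl.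
by rewrite sumr_ge0 // => i _; apply: padic_abs_ge0.
Qed.

Lemma cauchy_seq_subring : subring_closed cauchy_seq.
Proof.
split.
- apply/asboolP => e e0; exists 0%N => i j _ _.
  by rewrite /= subrr padic_abs0.
- move=> u v /asboolP uC /asboolP vC; apply/asboolP => e e0.
  have [N1 uN] := uC e e0; have [N2 vN] := vC e e0.
  exists (maxn N1 N2) => i j; rewrite !geq_max => /andP[i1 i2] /andP[j1 j2].
  have -> : (u - v) i - (u - v) j = (u i - u j) - (v i - v j).
    by rewrite -[LHS]/(u i - v i - (u j - v j)) opprD addrACA -opprD.
  by rewrite (le_lt_trans (padic_absB _ _)) // gt_max uN ?vN.
- move=> u v uC vC.
  have [M M0 uM] := cauchy_seq_bounded uC.
  have [K K0 vK] := cauchy_seq_bounded vC.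
  move: uC vC => /asboolP uC /asboolP vC; apply/asboolP => e e0.
  have [N1 uN] := uC (e / K) (divr_gt0 e0 K0).
  have [N2 vN] := vC (e / M) (divr_gt0 e0 M0).
  exists (maxn N1 N2) => i j; rewrite !geq_max => /andP[i1 i2] /andP[j1 j2].
  have -> : (u * v) i - (u * v) j = u i * (v i - v j) + (u i - u j) * v j.
    by rewrite mulrBr mulrBl addrA subrK.
  rewrite (le_lt_trans (padic_absD _ _)) // gt_max !padic_absM; apply/andP; split.
    rewrite (le_lt_trans (ler_wpM2r (padic_abs_ge0 _) (uM i))) //.
    by rewrite mulrC -ltr_pdivlMr // vN.
  rewrite (le_lt_trans (ler_wpM2l (padic_abs_ge0 _) (vK j))) //.
  by rewrite -ltr_pdivlMr // uN.
Qed.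

End RatPadicAbs.

Section CauchyRing.
Variables (p : nat) (p_pr : prime p).

HB.instance Definition _ :=
  GRing.isSubringClosed.Build _ (@cauchy_seq p) (cauchy_seq_subring p_pr).

(* The phantom primality proof lets the ring structure, which needs it, be
   inferred from the type. *)
Record cauchy_ring (pr : prime p) :=
  CauchySeq { cseq :> nat -> rat; cseqP : cseq \in @cauchy_seq p }.

HB.instance Definition _ := [isSub for @cseq p_pr].
HB.instance Definition _ := [Choice of cauchy_ring p_pr by <:].
HB.instance Definition _ :=
  [SubChoice_isSubComNzRing of cauchy_ring p_pr by <:].


Definition null_seq : {pred cauchy_ring p_pr} := fun u => `[<
  forall e : rat, 0 < e ->
  exists N, forall i, (N <= i)%N -> padic_abs p (u i) < e >].

Lemma null_seq_idealr : idealr_closed null_seq.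
Proof.
split.
- by apply/asboolP => e e0; exists 0%N => i _; rewrite padic_abs0.
- apply/negP => /asboolP /(_ 1 ltr01)[N /(_ N (leqnn N))].
  by rewrite padic_abs1 ltxx.
- move=> a u v /asboolP uN /asboolP vN; apply/asboolP => e e0.
  have [M M0 aM] := cauchy_seq_bounded p_pr (cseqP a).
  have [N1 {}uN] := uN (e / M) (divr_gt0 e0 M0).
  have [N2 {}vN] := vN e e0.
  exists (maxn N1 N2) => i; rewrite geq_max => /andP[i1 i2].
  rewrite -[X in padic_abs _ X]/(a i * u i + v i).
  rewrite (le_lt_trans (padic_absD p_pr _ _)) // gt_max vN // andbT.
  rewrite padic_absM // (le_lt_trans (ler_wpM2r (padic_abs_ge0 _ _) (aM i))) //.
  by rewrite mulrC -ltr_pdivlMr // uN.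
Qed.

HB.instance Definition _ := isIdealr.Build _ null_seq null_seq_idealr.

(* Q_p: the completion of the rationals, as Cauchy sequences modulo null
   sequences *)
Definition padic := {ideal_quot null_seq}.

HB.instance Definition _ := GRing.ComNzRing.on padic.

Lemma cauchy_seq_inv (u : cauchy_ring p_pr) : u \notin null_seq ->
  exists v : cauchy_ring p_pr, v * u - 1 \in null_seq.
Proof.
move=> uN.
have [c c0 [N uc]] : exists2 c : rat, 0 < c &
    exists N, forall i, (N <= i)%N -> c <= padic_abs p (u i).
  apply: contrapT => nex; move/negP: uN; apply; apply/asboolP => e e0.
  have /asboolP /(_ e e0)[N uC] := cseqP u.
  exists N => i Ni; rewrite ltNge; apply/negP => ei; apply: nex.
  exists e => //; exists N => j Nj; rewrite leNgt; apply/negP => je.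
  move: ei; rewrite leNgt => /negP; apply; rewrite -(subrK (u j) (u i)).
  by rewrite (le_lt_trans (padic_absD p_pr _ _)) // gt_max uC.
have u0 i : (N <= i)%N -> u i != 0.
  move=> Ni; apply: contraTneq (uc i Ni) => ->.
  by rewrite padic_abs0 -ltNge.
have vC : (fun i => (u i)^-1 : rat) \in @cauchy_seq p.
  apply/asboolP => e e0; have /asboolP uC := cseqP u.
  have [K uK] := uC (e * (c * c)) (mulr_gt0 e0 (mulr_gt0 c0 c0)).
  exists (maxn N K) => i j; rewrite !geq_max => /andP[i1 i2] /andP[j1 j2].
  have -> : (u i)^-1 - (u j)^-1 = (u j - u i) * ((u i)^-1 * (u j)^-1).
    rewrite mulrBl mulrCA divff ?u0 // mulr1 mulrA divff ?u0 // mul1r.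
    by [].
  rewrite !padic_absM // !padic_absV // -invfM.
  have cu i' : (N <= i')%N -> 0 < padic_abs p (u i').
    by move=> /uc; apply: lt_le_trans.
  rewrite ltr_pdivrMr ?mulr_gt0 ?cu //.
  by rewrite (lt_le_trans (uK _ _ j2 i2)) // ler_pM2l // ler_pM ?uc // ltW.
exists (CauchySeq p_pr vC); apply/asboolP => e e0; exists N => i Ni.
rewrite -[X in padic_abs _ X]/((u i)^-1 * u i - 1).
by rewrite mulVf ?u0 // subrr padic_abs0.
Qed.

Definition padic_inv (x : padic) : padic := xget 0 [set y | y * x = 1].

Lemma padic_mulVf (x : padic) : x != 0 -> padic_inv x * x = 1.
Proof.
move=> x0; suff [y yx] : exists y : padic, y * x = 1.
  by rewrite /padic_inv; case: xgetP => [z _ //|/(_ y)].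
move: x0; rewrite -[x]reprK => x0.
have [|v vu] := @cauchy_seq_inv (repr x).
  by move: x0; rewrite -(rmorph0 \pi_padic) -Quotient.idealrBE subr0.
exists (\pi_padic v); rewrite -rmorphM -(rmorph1 \pi_padic).
by apply/eqP; rewrite -Quotient.idealrBE.
Qed.

Lemma padic_inv0 : padic_inv 0 = 0.
Proof.
rewrite /padic_inv xgetPN // => y /eqP.
by rewrite /= mulr0 eq_sym oner_eq0.
Qed.

HB.instance Definition _ :=
  GRing.ComNzRing_isField.Build padic padic_mulVf padic_inv0.

End CauchyRing.

Notation "''Q_' [ p_pr ]" := (padic p_pr) (format "''Q_' [ p_pr ]").

Section PadicAnalysis.
Variables (R : realType) (p : nat) (p_pr : prime p).
Implicit Types x y l : 'Q_[p_pr].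

(* independent of the representative sequence [repr x] *)
Definition padic_norm x : R :=
  lim ((fun n => ratr (padic_abs p (repr x n)) : R) @ \oo).

Definition padic_cvg_to (u : nat -> 'Q_[p_pr]) l : Prop :=
  (fun n => padic_norm (u n - l)) @ \oo --> (0 : R).

Definition padic_exp_dom : set 'Q_[p_pr] :=
  [set x | padic_norm x < p%:R `^ (- (p.-1)%:R^-1)].

(* [xget] returns 0 where the exponential series diverges, which does not
   happen on [padic_exp_dom]. *)
Definition padic_exp x : 'Q_[p_pr] :=
  xget 0 [set l | padic_cvg_to (series (fun n => x ^+ n / n`!%:R)) l].

(* congruence modulo the ideal p Z_p, with Z_p the closed unit ball *)
Definition padic_eqmod x y : Prop :=
  exists2 z, padic_norm z <= 1 & x - y = p%:R * z.

End PadicAnalysis.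

(* For k >= 1 the vertex set is automatically infinite. *)
Record cayley_tree (k : nat) := CayleyTree {
  vertex :> choiceType;
  adj : rel vertex;
  root : vertex;
  adj_sym : symmetric adj;
  adj_irr : irreflexive adj;
  adj_connected : forall x y, exists2 s, path adj x s & last x s = y;
  adj_acyclic : forall c, uniq c -> (2 < size c)%N -> ~~ cycle adj c;
  adj_regular : forall x, exists s : seq vertex,
    [/\ uniq s, size s = k.+1 & s =i adj x] }.

Section Tree.
Variables (k : nat) (T : cayley_tree k).
Implicit Types x y : T.

Definition joined_by x y (n : nat) : bool :=
  `[< exists s, [/\ path (@adj k T) x s, last x s = y & size s = n] >].

Lemma joined_ex x y : exists n, joined_by x y n.
Proof.
by have [s xs sy] := adj_connected x y; exists (size s); apply/asboolP; exists s.
Qed.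

Definition tree_dist x y : nat := ex_minn (joined_ex x y).

(* [fset_set] is junk on infinite sets; see [in_sphere] *)
Definition sphere n : {fset T} := fset_set [set x : T | tree_dist x (root T) = n].

Definition tball n : {fset T} := (\bigcup_(j <- iota 0 n.+1) sphere j)%fset.

Lemma finite_joined n y : finite_set [set x | joined_by x y n].
Proof.
elim: n y => [|n IHn] y.
  apply: (sub_finite_set _ (finite_set1 y)) => x /asboolP[s [_ <- /size0nil ->]].
  by [].
have [s [_ _ sE]] := adj_regular y.
apply: (@sub_finite_set _ _ (\bigcup_(z in [set` s]) [set x | joined_by x z n])).
  move=> x /asboolP[t [+ + tn]].
  case/lastP: t tn => [//|t z]; rewrite size_rcons last_rcons rcons_path.
  move=> [tn] /andP[xt tz] zy; exists (last x t).
    by rewrite /= sE -topredE /= -zy adj_sym.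
  by apply/asboolP; exists t.
by apply: bigcup_finite => // z _; apply: IHn.
Qed.

Lemma in_sphere n x : (x \in sphere n) = (tree_dist x (root T) == n).
Proof.
rewrite in_fset_set; first by apply/idP/eqP; rewrite inE.
apply: sub_finite_set (finite_joined n (root T)) => y <- /=.
by rewrite /tree_dist; case: ex_minnP.
Qed.

Lemma in_tball n x : (x \in tball n) = (tree_dist x (root T) <= n)%N.
Proof.
apply/bigfcupP/idP => [[j]|xn].
  by rewrite in_sphere andbT mem_iota => /[swap] /eqP ->.
by exists (tree_dist x (root T)); rewrite ?in_sphere // mem_iota andbT.
Qed.

Lemma tball_sphere n x : x \in tball n.+1 -> x \notin tball n -> x \in sphere n.+1.
Proof.
rewrite !in_tball in_sphere -ltnNge => xn nx.
by rewrite eqn_leq xn.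
Qed.

End Tree.

Section Potts.
Variables (R : realType) (p : nat) (p_pr : prime p).
Variables (k : nat) (T : cayley_tree k) (q : nat) (J : 'Q_[p_pr]).
Local Notation Qp := 'Q_[p_pr].
Local Notation exp_p := (padic_exp R).
Local Notation V := (tball T).
Local Notation W := (sphere T).

Definition conf (L : {fset T}) := {ffun L -> 'I_q}.

Definition restr (L : {fset T}) (s : T -> 'I_q) : conf L := [ffun x => s (val x)].

Definition concat n (s : conf (V n)) (w : conf (W n.+1)) : conf (V n.+1) :=
  [ffun x => match boolP (val x \in V n) with
             | AltTrue xV => s [` xV]%fset
             | AltFalse xV => w [` tball_sphere (valP x) xV]%fset
             end].

(* unordered pairs of adjacent vertices, both lying in the ball *)
Definition edges n : {set {set V n}} :=
  [set [set e.1; e.2] | e in [set e : V n * V n | adj (val e.1) (val e.2)]]%SET.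

Definition hamiltonian n (s : conf (V n)) : Qp :=
  J * \sum_(e in edges n) [forall x in e, forall y in e, s x == s y]%:R.

Variable h : T -> 'I_q -> Qp.

Definition weight n (s : conf (V n)) : Qp :=
  exp_p (hamiltonian s + \sum_(x : V n | val x \in W n) h (val x) (s x)).

Definition partition_fun n : Qp := \sum_(s : conf (V n)) weight s.

Definition gibbs_fin n (s : conf (V n)) : Qp := (partition_fun n)^-1 * weight s.

Definition compatible : Prop := forall n (s : conf (V n)),
  \sum_(w : conf (W n.+1)) gibbs_fin (concat s w) = gibbs_fin s.

End Potts.

Section Gibbs.
Variables (R : realType) (p : nat) (p_pr : prime p).
Variables (k : nat) (T : cayley_tree k) (q : nat) (J : 'Q_[p_pr]).
Local Notation Qp := 'Q_[p_pr].
Local Notation V := (tball T).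

Definition cylinder n (s : conf q (V n)) : set (T -> 'I_q) :=
  [set t | restr (V n) t = s].

Definition cylinder_algebra : set (set (T -> 'I_q)) :=
  [set A | exists n (B : {set conf q (V n)}),
     A = [set t | restr (V n) t \in B]].

(* C ranges over the elements of the algebra equal to a disjoint union of A and
   B, so the closure of the algebra under unions need not be carried along. *)
Definition padic_prob_measure (mu : cylinder_algebra -> Qp) : Prop :=
  (forall A B C : cylinder_algebra, val A `&` val B = set0 ->
     val C = val A `|` val B -> mu C = mu A + mu B) /\
  (forall A : cylinder_algebra, val A = setT -> mu A = 1).

Definition gibbs_measures : set (cylinder_algebra -> Qp) :=
  [set mu | padic_prob_measure mu /\ exists h : T -> 'I_q -> Qp,
    [/\ forall x i, padic_exp_dom R (h x i),
        forall n, partition_fun R J h n != 0,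
        compatible R J h &
        forall n (s : conf q (V n)) (A : cylinder_algebra),
          val A = cylinder s -> mu A = gibbs_fin R J h s]].

End Gibbs.

Arguments gibbs_measures R {p p_pr k} T q J.

(* Main.v *)
(* Write f = x on a set A of m spins and f = 1 off it, with x = 1 - q/m. Then
   f sums to 0, and since theta = 1 - q the sum over j of
   theta^[j = i] f(j)^3 equals m (x^3 - 1) f(i): the law f^3 is invariant under
   the recursion of the tree. The constant law f = 1 has vanishing partition
   function, so it yields no measure, and the additional measure has to come
   from elsewhere. Below the root three branches carry the law of A and the
   fourth the law of a singleton {b}, whose ratio is 1 - q = exp_p(J). The
   law at the root is then x^3 on A, times exp_p(J) at b. It always lies in the
   image of exp_p, whereas four branches of type A would give x^4, which is not
   1 mod p in case c. The pairs (A, b) give q * C(q, m) distinct measures,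
   because a measure determines the law of every vertex up to a scalar and x is
   not a sixth root of unity (q <> 2m). *)
From HB Require Import structures.
Require Import Defs.
From mathcomp Require Import all_boot all_order all_algebra finmap.
From mathcomp Require Import generic_quotient ring_quotient.
From mathcomp Require Import all_classical all_reals.
From mathcomp Require Import topology normedtype sequences exp.
From mathcomp Require Import ring zify.

Set Implicit Arguments.
Unset Strict Implicit.
Unset Printing Implicit Defensive.

Import Order.TTheory GRing.Theory Num.Theory.
Import numFieldNormedType.Exports.

Local Open Scope quotient_scope.
Local Open Scope classical_set_scope.
Local Open Scope ring_scope.

(** * The norm of the p-adic numbers *)

(** Origin of x: a two-valued f with values x on A and 1 off it makes f^3 invariant when S - q
    f(i)^3 = c f(i) for some constant c, where S = m x^3 + q - m is the full sum of f^3. So 1 and x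
    are roots of q X^3 + c X - S. There is no X^2 term, hence the third root is -(1 + x), and
    comparing constant terms gives (x^2 + x + 1)(m (x - 1) + q) = 0. The second factor yields x = 1
    - q/m.

    A Gibbs measure needs logarithms of its law inside the domain of [padic_exp], so what must be
    established is that x^3 is an exponential. For this the exponential is shown to map its domain
    onto the ball of the same radius around 1, and x^3 - 1 = (x - 1)(x^2 + x + 1) is estimated:
    since |x - 1| = |q/m|, cases a and b make the first factor small and case c the second.

    Nonvanishing is the other obstacle: p-adic weights have no positivity, so every normalizing
    constant has to be computed as a product of known nonzero factors. *)

Section PadicNorm.
Variables (R : realType) (p : nat) (p_pr : prime p).
Implicit Types (u v w : cauchy_ring p_pr) (x y z : 'Q_[p_pr]).
Local Notation norm := (@padic_norm R p p_pr).
Local Notation abs := (padic_abs p).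

Lemma rat_between0 (e : R) : 0 < e -> exists2 d : rat, 0 < d & ratr d < e.
Proof.
move=> /rat_in_itvoo[d]; rewrite in_itv /= ltr0q => /andP[d0 de].
by exists d.
Qed.

Lemma padic_abs_lip (a b : rat) : `|abs a - abs b| <= abs (a - b).
Proof.
have half (c d : rat) : abs c - abs d <= abs (c - d).
  rewrite lerBlDr -{1}(subrK d c) (le_trans (padic_absD p_pr _ _)) //.
  by rewrite ge_max lerDl lerDr !padic_abs_ge0.
by rewrite ler_norml lerNl opprB half andbT padic_distC // half.
Qed.

Lemma is_cvg_abs u : cvgn (fun n => ratr (abs (u n)) : R).
Proof.
apply/cauchy_cvgP/cauchy_exP => e /= e0.
have [d d0 de] := rat_between0 e0.
have /asboolP /(_ d d0) [N uN] := cseqP u.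
exists (ratr (abs (u N))); exists N => // n /= Nn.
rewrite /ball /= -rmorphB -ratr_norm (le_lt_trans _ de) // ler_rat.
by rewrite (le_trans (padic_abs_lip _ _)) // ltW // uN.
Qed.

Lemma cvg_abs_null u : u \in @null_seq p p_pr ->
  (fun n => ratr (abs (u n)) : R) @ \oo --> (0 : R).
Proof.
move=> /asboolP u0; apply/cvgr0Pnorm_lt => e e0.
have [d d0 de] := rat_between0 e0.
have [N uN] := u0 d d0; exists N => // n /= Nn.
by rewrite -ratr_norm (lt_trans _ de) // ltr_rat ger0_norm ?padic_abs_ge0 ?uN.
Qed.

(** [padic_norm] is defined through the chosen representative [repr]. Two representatives differ by
    a null sequence and [padic_abs] is 1-Lipschitz, so any Cauchy sequence of the class computes the
    norm. The algebraic rules for the norm then pass to the limit. *)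
Lemma cvg_padic_norm u :
  (fun n => ratr (abs (u n)) : R) @ \oo --> norm (\pi_(padic p_pr) u).
Proof.
set v := repr (\pi_(padic p_pr) u).
have uv : u - v \in @null_seq p p_pr.
  by rewrite Quotient.idealrBE reprK.
have vl : (fun n => ratr (abs (v n)) : R) @ \oo --> norm (\pi_(padic p_pr) u).
  exact: is_cvg_abs.
suff : (fun n => ratr (abs (u n)) - ratr (abs (v n)) : R) @ \oo --> (0 : R).
  move=> /cvgD /(_ vl); rewrite add0r; apply: cvg_trans; apply: near_eq_cvg.
  by near=> n; rewrite fctE subrK.
apply/norm_cvg0P; apply: squeeze_cvgr (cvg_cst 0) (cvg_abs_null uv).
near=> n; rewrite normr_ge0 /= -rmorphB -ratr_norm ler_rat.
exact: padic_abs_lip.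
Unshelve. all: by end_near. Qed.

Let cvg_uniqueR (f : nat -> R) (a b : R) : f @ \oo --> a -> f @ \oo --> b -> a = b.
Proof. exact: cvg_unique. Qed.

Lemma padic_normP (P : 'Q_[p_pr] -> Prop) :
  (forall u, P (\pi_(padic p_pr) u)) -> forall x, P x.
Proof. by move=> Pu x; rewrite -[x]reprK. Qed.

Lemma padic_normM x y : norm (x * y) = norm x * norm y.
Proof.
elim/padic_normP: x => u; elim/padic_normP: y => v; rewrite -rmorphM.
apply: (cvg_uniqueR (@cvg_padic_norm _)).
rewrite [X in X @ _ --> _](_ : _ =
    (fun n => ratr (abs (u n)) : R) \* (fun n => ratr (abs (v n)) : R)).
  exact: cvgM (@cvg_padic_norm u) (@cvg_padic_norm v).
by apply/funext => n /=; rewrite -rmorphM -padic_absM.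
Qed.

Lemma padic_norm_ge0 x : 0 <= norm x.
Proof.
elim/padic_normP: x => u; apply: cvgr_to_ge (@cvg_padic_norm u) _.
by near=> n; rewrite ler0q padic_abs_ge0.
Unshelve. all: by end_near. Qed.

Lemma padic_normD x y : norm (x + y) <= Num.max (norm x) (norm y).
Proof.
elim/padic_normP: x => u; elim/padic_normP: y => v; rewrite -rmorphD.
rewrite leNgt; apply/negP; rewrite gt_max => /andP[ul vl].
(* A value [m] strictly between the two sides: eventually both [abs (u n)] and [abs (v n)] lie below
   [m], hence so does the absolute value of the sum, and the limit cannot exceed [m]. *)
have /rat_in_itvoo[a] : Num.max (norm (\pi_(padic p_pr) u))
    (norm (\pi_(padic p_pr) v)) < norm (\pi_(padic p_pr) (u + v)).
  by rewrite gt_max ul.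
rewrite in_itv /= gt_max.
move: (ratr a : R) => m /andP[/andP[um vm] uvm].
move: uvm; rewrite ltNge => /negP; apply.
apply: cvgr_to_le (@cvg_padic_norm (u + v)) _.
near=> n; have /= un : ratr (abs (u n)) < m.
  by near: n; apply: (cvgr_lt _ (@cvg_padic_norm u)).
have /= vn : ratr (abs (v n)) < m.
  by near: n; apply: (cvgr_lt _ (@cvg_padic_norm v)).
have := padic_absD p_pr (u n) (v n).
by rewrite le_max => /orP[]; rewrite -(ler_rat R) => /le_trans; apply; apply: ltW.
Unshelve. all: by end_near. Qed.

Lemma cauchy_seq_cst (a : rat) : (fun=> a) \in @cauchy_seq p.
Proof. by apply/asboolP => e e0; exists 0%N => i j _ _; rewrite subrr padic_abs0. Qed.

Definition padic_of_rat (a : rat) : 'Q_[p_pr] :=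
  \pi_(padic p_pr) (CauchySeq p_pr (cauchy_seq_cst a)).

Lemma padic_norm_pi_le u v (d : rat) :
  (exists N, forall n, (N <= n)%N -> abs (u n - v n) <= d) ->
  norm (\pi_(padic p_pr) u - \pi_(padic p_pr) v) <= ratr d.
Proof.
move=> [N uN].
have -> : \pi_(padic p_pr) u - \pi_(padic p_pr) v = \pi_(padic p_pr) (u - v).
  by rewrite rmorphB.
apply: cvgr_to_le (@cvg_padic_norm (u - v)) _.
by exists N => // n /uN uvn; rewrite ler_rat.
Qed.

Lemma padic_norm_rat a : norm (padic_of_rat a) = ratr (abs a).
Proof.
apply: (cvg_uniqueR (@cvg_padic_norm _)).
exact: (cvg_cst (ratr (abs a) : R)).
Qed.

Lemma padic_of_rat_is_zmod : zmod_morphism padic_of_rat.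
Proof.
move=> a b; rewrite /padic_of_rat -rmorphB; congr (\pi_(_) _).
exact: val_inj.
Qed.

Lemma padic_of_rat_is_monoid : monoid_morphism padic_of_rat.
Proof.
split=> [|a b]; rewrite /padic_of_rat -?rmorphM -?(rmorph1 (\pi_(padic p_pr)));
  congr (\pi_(_) _); exact: val_inj.
Qed.

HB.instance Definition _ :=
  GRing.isZmodMorphism.Build rat 'Q_[p_pr] padic_of_rat padic_of_rat_is_zmod.
HB.instance Definition _ :=
  GRing.isMonoidMorphism.Build rat 'Q_[p_pr] padic_of_rat padic_of_rat_is_monoid.

Lemma padic_norm_nat n : norm n%:R = ratr (abs n%:R).
Proof. by rewrite -padic_norm_rat rmorph_nat. Qed.

Lemma padic_norm0 : norm 0 = 0.
Proof. by rewrite -[0]/(0%:R) padic_norm_nat padic_abs0 rmorph0. Qed.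

Lemma padic_norm1 : norm 1 = 1.
Proof. by rewrite -[1]/(1%:R) padic_norm_nat padic_abs1 rmorph1. Qed.

Lemma padic_normN x : norm (- x) = norm x.
Proof.
have N1 : norm (- 1) = 1.
  by rewrite -(rmorphN1 padic_of_rat) padic_norm_rat padic_absN padic_abs1 rmorph1.
by rewrite -mulN1r padic_normM N1 mul1r.
Qed.

Lemma padic_norm_distC x y : norm (x - y) = norm (y - x).
Proof. by rewrite -padic_normN opprB. Qed.

Lemma padic_norm_eq0 x : (norm x == 0) = (x == 0).
Proof.
apply/eqP/eqP => [|->]; last exact: padic_norm0.
move=> x0; apply/eqP; apply: contra_eqT x0 => /mulfV xV.
have := padic_normM x x^-1; rewrite xV padic_norm1 => E.
by apply: contra_eq_neq E => ->; rewrite mul0r oner_eq0.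
Qed.

Lemma padic_norm_gt0 x : (0 < norm x) = (x != 0).
Proof. by rewrite lt_def padic_norm_ge0 padic_norm_eq0 andbT. Qed.

Lemma padic_normX x n : norm (x ^+ n) = norm x ^+ n.
Proof.
by elim: n => [|n IHn]; rewrite ?expr0 ?padic_norm1 // !exprS padic_normM IHn.
Qed.

Lemma padic_normV x : norm x^-1 = (norm x)^-1.
Proof.
have [->|x0] := eqVneq x 0; first by rewrite invr0 padic_norm0 invr0.
have nx0 : norm x != 0 by rewrite padic_norm_eq0.
by apply: (mulfI nx0); rewrite -padic_normM !mulfV // padic_norm1.
Qed.

Lemma padic_rat_dense x (e : R) : 0 < e ->
  exists a, norm (x - padic_of_rat a) < e.
Proof.
elim/padic_normP: x => u e0; have [d d0 de] := rat_between0 e0.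
have /asboolP /(_ d d0) [N uN] := cseqP u.
exists (u N); rewrite (le_lt_trans _ de) // padic_norm_pi_le //.
by exists N => n Nn; rewrite ltW ?uN.
Qed.

(** Diagonal argument: each [u n] is replaced by a rational [a n] at distance below 1/(n+1). The
    sequence [a] is itself a Cauchy sequence of rationals, and its class is the limit. *)
Lemma padic_complete (u : nat -> 'Q_[p_pr]) :
  (forall e : R, 0 < e -> exists N, forall i j, (N <= i)%N -> (N <= j)%N ->
     norm (u i - u j) < e) ->
  exists x, forall e : R, 0 < e -> exists N, forall n, (N <= n)%N ->
    norm (u n - x) < e.
Proof.
move=> uC.
have /choice[a ua] (n : nat) : exists a, norm (u n - padic_of_rat a) < n.+1%:R^-1.
  by apply: padic_rat_dense; rewrite invr_gt0.
have ua_small (e : R) : 0 < e -> exists N, forall n, (N <= n)%N ->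
    norm (u n - padic_of_rat (a n)) < e.
  move=> e0; exists (Num.trunc e^-1) => n Nn; apply: lt_trans (ua n) _.
  rewrite invf_plt ?posrE // (lt_le_trans (truncnS_gt _)) //.
  by rewrite ler_nat ltnS.
have aC : a \in @cauchy_seq p.
  apply/asboolP => d d0; have e0 : 0 < ratr d :> R by rewrite ltr0q.
  have [N uN] := uC _ e0; have [M aM] := ua_small _ e0.
  exists (maxn N M) => i j; rewrite !geq_max => /andP[Ni Mi] /andP[Nj Mj].
  rewrite -(ltr_rat R) -padic_norm_rat rmorphB /=.
  rewrite -(subrKA (u i)) (le_lt_trans (padic_normD _ _)) // gt_max.
  rewrite padic_norm_distC aM //= -(subrKA (u j)).
  by rewrite (le_lt_trans (padic_normD _ _)) // gt_max uN ?aM.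
exists (\pi_(padic p_pr) (CauchySeq p_pr aC)) => e e0.
have [N uN] := ua_small _ e0; have [d d0 de] := rat_between0 e0.
have /asboolP /(_ d d0) [M aM] := aC.
exists (maxn N M) => n; rewrite geq_max => /andP[Nn Mn].
rewrite -(subrKA (padic_of_rat (a n))) (le_lt_trans (padic_normD _ _)) //.
rewrite gt_max uN //= (le_lt_trans _ de) // padic_norm_pi_le //.
by exists M => i Mi; rewrite ltW ?aM.
Qed.

End PadicNorm.

(** * The p-adic exponential *)

(** With r = p^(-1/(p-1)) this says |n!| >= r^(n-1) for n > 0. The exponent n - 1 instead of n is
    what later leaves a spare factor |x| in the bound on x^n/n!. *)
Lemma logn_fact_le p n : prime p -> (p.-1 * logn p n`! <= n.-1)%N.
Proof.
move=> p_pr; have p0 := prime_gt0 p_pr.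
case: n => [|n]; first by rewrite logn1 muln0.
rewrite logn_fact //; set m := n.+1.
(* The [maxn 1 _] term is what turns the bound n of Legendre's formula into n - 1. *)
suff H N : (p.-1 * \sum_(1 <= k < N.+1) m %/ p ^ k + maxn 1 (m %/ p ^ N) <= m)%N.
  by have := H m; lia.
elim: N => [|N IHN]; first by rewrite big_geq // expn0 divn1 /m; lia.
rewrite big_nat_recr //= expnSr divnMA mulnDr.
move: IHN; set S := \sum_(_ <= _ < _) _; set a := (m %/ p ^ N)%N.
(* What remains is (p-1) b + max(1, b) <= max(1, a) with p b <= a, immediate once b = 0 is separated
   from b > 0. *)
have := leq_trunc_div a p; set b := (a %/ p)%N; case: b => [|b]; nia.
Qed.

(* [K] stands for Q_p, kept abstract so that no step of these proofs can unfold
   the quotient of Cauchy sequences. *)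
Section UltrametricExp.
Variables (R : realType) (p : nat) (K : fieldType) (norm : K -> R).
Hypothesis p_pr : prime p.
Hypothesis norm_ge0 : forall x, 0 <= norm x.
Hypothesis norm_eq0 : forall x, (norm x == 0) = (x == 0).
Hypothesis norm1 : norm 1 = 1.
Hypothesis normN : forall x, norm (- x) = norm x.
Hypothesis normM : forall x y, norm (x * y) = norm x * norm y.
Hypothesis normD : forall x y, norm (x + y) <= Num.max (norm x) (norm y).
Hypothesis norm_nat : forall n, (0 < n)%N -> norm n%:R = p%:R ^- logn p n.
Hypothesis complete : forall u : nat -> K,
  (forall e : R, 0 < e -> exists N, forall i j, (N <= i)%N -> (N <= j)%N ->
     norm (u i - u j) < e) ->
  exists x, forall e : R, 0 < e -> exists N, forall n, (N <= n)%N ->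
    norm (u n - x) < e.

Let r : R := p%:R `^ (- (p.-1)%:R^-1).

Let cvg_to (u : nat -> K) x := (fun n => norm (u n - x)) @ \oo --> (0 : R).

Let cvg_toP (u : nat -> K) x :
  cvg_to u x <->
  forall e : R, 0 < e -> exists N, forall n, (N <= n)%N -> norm (u n - x) < e.
Proof.
rewrite /cvg_to; split=> [/cvgr0Pnorm_lt ux e /ux [N _ uN]|ux].
  by exists N => n /uN /=; rewrite ger0_norm.
apply/cvgr0Pnorm_lt => e /ux[N uN]; exists N => // n /uN /=.
by rewrite ger0_norm.
Qed.

Let uexp (x : K) : K :=
  xget 0 [set l | cvg_to (series (fun n => x ^+ n / n`!%:R)) l].

Let norm0 : norm 0 = 0.
Proof. by apply/eqP; rewrite norm_eq0. Qed.

Let normX x n : norm (x ^+ n) = norm x ^+ n.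
Proof. by elim: n => [|n IHn]; rewrite ?expr0 ?norm1 // !exprS normM IHn. Qed.

Let normV x : norm x^-1 = (norm x)^-1.
Proof.
have [->|x0] := eqVneq x 0; first by rewrite invr0 norm0 invr0.
have nx0 : norm x != 0 by rewrite norm_eq0.
by apply: (mulfI nx0); rewrite -normM !mulfV.
Qed.

Let norm_distC x y : norm (x - y) = norm (y - x).
Proof. by rewrite -normN opprB. Qed.

Let norm_tri c x y : norm x <= c -> norm y <= c -> norm (x + y) <= c.
Proof. by move=> xc yc; rewrite (le_trans (normD _ _)) // ge_max xc. Qed.

Let norm_sum_le (I : Type) (s : seq I) (P : pred I) (F : I -> K) (c : R) :
  0 <= c -> (forall i, P i -> norm (F i) <= c) ->
  norm (\sum_(i <- s | P i) F i) <= c.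
Proof.
move=> c0 Fc; elim/big_ind: _ => [|x y xc yc|//]; first by rewrite norm0.
exact: norm_tri.
Qed.

Let expr_small (a e : R) : 0 <= a < 1 -> 0 < e ->
  exists N, forall n, (N <= n)%N -> a ^+ n < e.
Proof.
move=> /andP[a0 a1] e0; have := @cvg_expr R a.
rewrite ger0_norm // => /(_ a1) /cvgr0Pnorm_lt /(_ e e0) [N _ aN].
by exists N => n /aN /=; rewrite ger0_norm ?exprn_ge0.
Qed.

Let small_eq0 (a c : R) x : 0 <= a < 1 ->
  (forall n, norm x <= c * a ^+ n) -> x = 0.
Proof.
move=> a01 xa; apply/eqP; rewrite -norm_eq0 eq_le norm_ge0 andbT.
(* [c] may be zero or negative, so the division is by [|c| + 1]. *)
have c1 : 0 < `|c| + 1 by rewrite ltr_wpDl.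
rewrite leNgt; apply/negP => x0.
have [N /(_ N (leqnn N)) aN] := expr_small a01 (divr_gt0 x0 c1).
have /andP[a0 _] := a01.
have := xa N; rewrite leNgt => /negP; apply.
apply: le_lt_trans (_ : _ <= (`|c| + 1) * a ^+ N) _.
  by rewrite ler_wpM2r ?exprn_ge0 // (le_trans (ler_norm _)) // lerDl.
by rewrite mulrC -ltr_pdivlMr.
Qed.

Let p1 : (1 < p)%N := prime_gt1 p_pr.
Let pR0 : 0 < p%:R :> R. Proof. by rewrite ltr0n prime_gt0. Qed.
Let pV0 : 0 < p.-1%:R :> R. Proof. by rewrite ltr0n -subn1 subn_gt0. Qed.

Let r0 : 0 < r. Proof. exact: powR_gt0. Qed.

Let rp : r ^+ p.-1 = p%:R^-1.
Proof.
by rewrite -powR_mulrn ?(ltW r0) // -powRrM mulNr mulVf ?gt_eqF // powR_inv1 // ltW.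
Qed.

Let r1 : r < 1.
Proof.
rewrite ltNge; apply/negP => /(exprn_ege1 p.-1).
by rewrite rp leNgt invf_lt1 // ltr1n p1.
Qed.

Let norm_fact_ge n : r ^+ n.-1 <= norm n`!%:R.
Proof.
rewrite norm_nat ?fact_gt0 // -exprVn -rp -exprM.
by rewrite ler_wiXn2l ?ltW // logn_fact_le.
Qed.

Let term x n : K := x ^+ n / n`!%:R.

(** The factor [norm x] kept in front makes every term of degree at least 2 strictly smaller than a
    nonzero linear term inside the disc, which is the source of the isometry property. *)
Let norm_termS x n : norm (term x n.+1) <= norm x * (norm x / r) ^+ n.
Proof.
rewrite /term normM normX normV exprS -mulrA ler_wpM2l // expr_div_n.
rewrite ler_wpM2l ?exprn_ge0 // lef_pV2 ?posrE ?exprn_gt0 //.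
  exact: (norm_fact_ge n.+1).
exact: lt_le_trans (exprn_gt0 _ _) (norm_fact_ge n.+1).
Qed.

Let norm_term x n (a : R) : norm x <= a * r -> norm (term x n) <= a ^+ n.
Proof.
move=> xa; have a0 : 0 <= a.
  by rewrite -(pmulr_lge0 _ r0) (le_trans (norm_ge0 x)).
case: n => [|n]; first by rewrite /term expr0 mul1r invr1 norm1.
apply: le_trans (norm_termS x n) _; rewrite exprS ler_pM ?exprn_ge0 //.
- by rewrite divr_ge0 // ltW.
- by rewrite (le_trans xa) // ler_piMr // ltW.
- by rewrite lerXn2r ?nnegrE ?divr_ge0 // ?(ltW r0) // ler_pdivrMr.
Qed.

Let ratio x : norm x < r -> exists2 a : R, 0 <= a < 1 & norm x <= a * r.
Proof.
move=> xr; exists (norm x / r); last by rewrite divfK ?gt_eqF.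
by rewrite divr_ge0 ?(ltW r0) //= ltr_pdivrMr // mul1r.
Qed.

Let norm_lim_le (u : nat -> K) x y (c : R) N : cvg_to u x ->
  (forall n, (N <= n)%N -> norm (u n - y) <= c) -> norm (x - y) <= c.
Proof.
move=> /cvg_toP ux uc; rewrite leNgt; apply/negP => cxy.
have [M uM] := ux _ (le_lt_trans (le_trans (norm_ge0 _) (uc N (leqnn N))) cxy).
(* For a late index, x - y is the sum of x - u_n and u_n - y, both strictly shorter than x - y
   itself, against the ultrametric inequality. *)
suff : norm (x - y) < norm (x - y) by rewrite ltxx.
rewrite -[X in norm X < _](subrKA (u (maxn N M))).
rewrite (le_lt_trans (normD _ _)) // gt_max (norm_distC x (u _)).
rewrite (uM (maxn N M) (leq_maxr _ _)) /=.
exact: le_lt_trans (uc (maxn N M) (leq_maxl _ _)) cxy.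
Qed.

Let series_cvg x : norm x < r -> exists l, cvg_to (series (term x)) l.
Proof.
move=> /ratio[a a01 xa]; have a0 : 0 <= a by case/andP: a01.
suff /complete[l ul] : forall e : R, 0 < e -> exists N, forall i j,
    (N <= i)%N -> (N <= j)%N -> norm (series (term x) i - series (term x) j) < e.
  by exists l; apply/cvg_toP.
move=> e e0; have [N aN] := expr_small a01 e0.
have H i j : (N <= i)%N -> (i <= j)%N ->
    norm (series (term x) j - series (term x) i) < e.
  move=> Ni ij; rewrite sub_series ij; apply: le_lt_trans (aN N (leqnn N)).
  rewrite big_nat_cond; apply: norm_sum_le; rewrite ?exprn_ge0 // => k.
  rewrite andbT => /andP[ik _]; rewrite (le_trans (norm_term _ xa)) //.
  rewrite ler_wiXn2l // ?(leq_trans Ni) //.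
  by case/andP: a01 => _ /ltW.
exists N => i j Ni Nj; have [ij|/ltnW ji] := leqP i j; last exact: H.
by rewrite norm_distC H.
Qed.

Let uexp_cvg x : norm x < r -> cvg_to (series (term x)) (uexp x).
Proof.
move=> /series_cvg[l xl]; rewrite /uexp; case: xgetP => [y _ //|/(_ l)].
by move/(_ xl).
Qed.

Let uexp_near x n (a : R) : 0 <= a < 1 -> norm x <= a * r ->
  norm (uexp x - series (term x) n) <= a ^+ n.
Proof.
move=> a01 xa; have /andP[a0 a1] := a01.
have xr : norm x < r by rewrite (le_lt_trans xa) // gtr_pMl.
apply: (norm_lim_le (N := n) (uexp_cvg xr)) => m nm; rewrite sub_series nm.
rewrite big_nat_cond; apply: norm_sum_le; rewrite ?exprn_ge0 // => k.
rewrite andbT => /andP[nk _]; rewrite (le_trans (norm_term _ xa)) //.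
by rewrite ler_wiXn2l // ltW.
Qed.

Lemma uexp_sub_lin x : norm x < r ->
  norm (uexp x - 1 - x) <= norm x * (norm x / r).
Proof.
move=> xr; have xr0 : 0 <= norm x / r by rewrite divr_ge0 // ltW.
rewrite -addrA -opprD.
apply: (norm_lim_le (N := 2) (uexp_cvg xr)) => n n2.
have -> : 1 + x = series (term x) 2.
  rewrite !seriesSr seriesEnat /= big_nil add0r.
  by rewrite /term expr0 expr1 mul1r invr1 mulr1.
rewrite sub_series n2 big_nat_cond; apply: norm_sum_le => [|[|[|k]] //].
  by rewrite mulr_ge0.
move=> _; apply: le_trans (norm_termS _ _) _; rewrite ler_wpM2l // exprS.
by rewrite ler_piMr // exprn_ile1 // ler_pdivrMr // mul1r ltW.
Qed.

(** The error of the linear approximation is strictly smaller than x when x is nonzero, and in an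
    ultrametric space a strictly smaller perturbation does not change the norm. *)
Lemma uexp_sub1 x : norm x < r -> norm (uexp x - 1) = norm x.
Proof.
move=> xr; have [->|x0] := eqVneq x 0.
  have := @uexp_sub_lin 0; rewrite subr0 norm0 mul0r => /(_ r0) H.
  by apply/eqP; rewrite eq_le H norm_ge0.
have nx0 : 0 < norm x by rewrite lt_def norm_eq0 x0 /=.
have lt : norm (uexp x - 1 - x) < norm x.
  by rewrite (le_lt_trans (uexp_sub_lin xr)) // gtr_pMr // ltr_pdivrMr // mul1r.
apply/eqP; rewrite eq_le; apply/andP; split.
  by rewrite -(subrK x (uexp x - 1)) norm_tri // ltW.
rewrite leNgt; apply/negP => lt2.
have := normD (x - (uexp x - 1)) (uexp x - 1); rewrite subrK leNgt.
by rewrite gt_max lt2 norm_distC lt.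
Qed.

Lemma uexp0 : uexp 0 = 1.
Proof.
by apply/eqP; rewrite -subr_eq0 -norm_eq0 uexp_sub1 norm0.
Qed.

Let norm_uexp_le x : norm x < r -> norm (uexp x) <= 1.
Proof.
move=> xr; rewrite -(subrK 1 (uexp x)) norm_tri ?norm1 //.
by rewrite uexp_sub1 // ltW // (lt_trans xr).
Qed.

Let series_termD x y n (a : R) : 0 <= a < 1 ->
  norm x <= a * r -> norm y <= a * r ->
  norm (series (term x) n * series (term y) n - series (term (x + y)) n)
    <= a ^+ n.
Proof.
move=> /andP[a0 a1] xa ya.
have nf k : k`!%:R != 0 :> K.
  by rewrite -norm_eq0 norm_nat ?fact_gt0 // gt_eqF // invr_gt0 exprn_gt0.
(* The difference collects the products of terms with i, j < n <= i + j. *)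
have -> : series (term (x + y)) n =
    \sum_(0 <= i < n) \sum_(0 <= j < n - i) term x i * term y j.
  transitivity (\sum_(0 <= k < n) \sum_(0 <= i < n | (i <= k)%N)
      term x i * term y (k - i)).
    apply: eq_big_nat => k /andP[_ kn].
    rewrite -[RHS](big_nat_widen 0 k.+1 n predT) //.
    rewrite /term addrC exprDn mulr_suml big_mkord; apply: eq_bigr => i _.
    have ik : (i <= k)%N by rewrite -ltnS.
    have := bin_fact ik => /(congr1 (fun m => m%:R : K)); rewrite !natrM => E.
    have bK : 'C(k, i)%:R / k`!%:R = (i`!%:R * (k - i)`!%:R)^-1 :> K.
      have b0 : 'C(k, i)%:R != 0 :> K.
        by apply: contraNneq (nf k) => b0; rewrite -E b0 mul0r.
      by rewrite -[RHS](mulKf b0) mulrCA -invfM E.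
    rewrite -[_ *+ 'C(k, i)]mulr_natr -!mulrA bK invfM; ring.
  rewrite (exchange_big_dep_nat predT) //=; apply: eq_big_nat => i /andP[_ i_n].
  rewrite -[n in LHS](subnK (ltnW i_n)) -(big_nat_widenl i 0 _ predT) //.
  rewrite -{1}[i]add0n big_addn addnK; apply: eq_big_nat => j _.
  by rewrite addnK.
have -> : series (term x) n * series (term y) n =
    \sum_(0 <= i < n) \sum_(0 <= j < n) term x i * term y j.
  by rewrite mulr_suml; apply: eq_bigr => i _; rewrite mulr_sumr.
rewrite -sumrB big_nat_cond; apply: norm_sum_le => [|i]; rewrite ?exprn_ge0 //.
rewrite andbT => /andP[_ i_n].
rewrite (big_cat_nat _ (n := (n - i)%N)) ?leq_subr //= addrAC subrr add0r.
rewrite big_nat_cond; apply: norm_sum_le => [|j]; rewrite ?exprn_ge0 //.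
rewrite andbT => /andP[ij _]; rewrite normM.
apply: le_trans (_ : a ^+ i * a ^+ j <= _).
  by rewrite ler_pM // norm_term.
by rewrite -exprD ler_wiXn2l // -?leq_subLR // ltW.
Qed.

Lemma uexpD x y : norm x < r -> norm y < r -> uexp (x + y) = uexp x * uexp y.
Proof.
move=> xr yr.
have [a a01 [xa ya]] :
    exists2 a : R, 0 <= a < 1 & norm x <= a * r /\ norm y <= a * r.
  have [a /andP[a0 a1] xa] := ratio xr; have [b /andP[b0 b1] yb] := ratio yr.
  exists (Num.max a b); first by rewrite le_max a0 gt_max a1 b1.
  by rewrite (le_trans xa) ?(le_trans yb) // ler_pM2r // le_max lexx ?orbT.
have xya : norm (x + y) <= a * r by apply: norm_tri.
apply/eqP; rewrite -subr_eq0; apply/eqP; apply: (small_eq0 (c := 1) a01) => n.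
rewrite mul1r.
have nx := norm_uexp_le xr.
have ny : norm (series (term y) n) <= 1.
  rewrite -(subKr (uexp y) (series _ _)) norm_tri ?norm_uexp_le // normN.
  rewrite (le_trans (uexp_near n a01 ya)) //.
  by case/andP: a01 => a0 /ltW a1; rewrite exprn_ile1.
(* Four errors, each at most a^n: truncation at x + y, the defect of the Cauchy product of partial
   sums, and the truncations of the two factors. *)
have -> : uexp (x + y) - uexp x * uexp y =
    (uexp (x + y) - series (term (x + y)) n) -
    (series (term x) n * series (term y) n - series (term (x + y)) n) -
    ((uexp x - series (term x) n) * series (term y) n +
     uexp x * (uexp y - series (term y) n)) by ring.
have an : 0 <= a ^+ n by rewrite exprn_ge0 //; case/andP: a01.
apply: norm_tri; last rewrite normN.
  by apply: norm_tri; rewrite ?normN ?series_termD // uexp_near.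
apply: norm_tri; rewrite normM.
  by rewrite -[a ^+ n]mulr1 ler_pM // uexp_near.
by rewrite -[a ^+ n]mul1r ler_pM // uexp_near.
Qed.

(* Newton's iteration a |-> a + (u exp(-a) - 1) contracts: if t = u exp(-a) - 1
   then the next error (1 + t) exp(-t) - 1 is of second order in t. *)
Lemma uexp_surj u : norm (u - 1) < r -> exists2 x, norm x < r & uexp x = u.
Proof.
set d := norm (u - 1) => dr; pose c := d / r.
have d0 : 0 <= d by apply: norm_ge0.
have c0 : 0 <= c by rewrite divr_ge0 // ltW.
have c1 : c < 1 by rewrite ltr_pdivrMr // mul1r.
have c01 : 0 <= c < 1 by rewrite c0.
have cn n : c ^+ n <= 1 by rewrite exprn_ile1 // ltW.
pose t a := u * uexp (- a) - 1.
pose a n := iter n (fun a => a + t a) 0.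
(* The first bound keeps all iterates in the disc, where the functional equation applies; the second
   gives geometric convergence. *)
have aP n : norm (a n) <= d /\ norm (t (a n)) <= d * c ^+ n.
  elim: n => [|n [an tn]] /=.
    by split; rewrite ?norm0 // /t oppr0 uexp0 expr0 !mulr1.
  have tn_d : norm (t (a n)) <= d by rewrite (le_trans tn) // ler_piMr.
  have ar : norm (a n) < r by rewrite (le_lt_trans an).
  have tr : norm (t (a n)) < r by rewrite (le_lt_trans tn_d).
  split; first exact: norm_tri.
  rewrite {1}/t opprD uexpD ?normN // mulrA.
  rewrite -[u * _](subrK 1) -/(t (a n)); set s := t (a n) in tn tn_d tr *.
  have -> : (s + 1) * uexp (- s) - 1 =
      (uexp (- s) - 1 - - s) + s * (uexp (- s) - 1) by ring.
  have sr : norm (- s) < r by rewrite normN.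
  have sc : norm s / r <= c by rewrite ler_pM2r ?invr_gt0.
  have bound : norm s * (norm s / r) <= d * c ^+ n.+1.
    by rewrite exprSr [d * _]mulrA ler_pM // ?divr_ge0 // ltW.
  rewrite norm_tri // ?normM.
    by rewrite (le_trans (uexp_sub_lin sr)) // normN.
  rewrite uexp_sub1 // normN (le_trans _ bound) // ler_wpM2l //.
  by rewrite ler_pdivlMr // ler_piMr // ltW.
have astep i j : (i <= j)%N -> norm (a j - a i) <= d * c ^+ i.
  elim: j => [|j IHj]; first by rewrite leqn0 => /eqP->; rewrite subrr norm0 mulr_ge0.
  rewrite leq_eqVlt => /orP[/eqP->|]; first by rewrite subrr norm0 mulr_ge0 ?exprn_ge0.
  rewrite ltnS => ij; rewrite /= addrAC norm_tri ?IHj //.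
  by case: (aP j) => _ /le_trans; apply; rewrite ler_wpM2l // ler_wiXn2l // ltW.
have small e : 0 < e -> exists N, forall n, (N <= n)%N -> d * c ^+ n < e.
  move=> e0; have d1 : 0 < d + 1 by rewrite ltr_wpDl.
  have [N cN] := expr_small c01 (divr_gt0 e0 d1); exists N => n /cN.
  rewrite ltr_pdivlMr // mulrC; apply: le_lt_trans.
  by rewrite ler_wpM2r ?exprn_ge0 // lerDl.
have [|x ax] := @complete a.
  move=> e /small[N cN]; exists N => i j Ni Nj.
  have [ij|/ltnW ji] := leqP i j.
    by rewrite norm_distC (le_lt_trans (astep _ _ ij)) ?cN.
  by rewrite (le_lt_trans (astep _ _ ji)) ?cN.
have xa n : norm (x - a n) <= d * c ^+ n.
  apply: (@norm_lim_le a _ _ _ n); first by apply/cvg_toP.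
  by move=> m; apply: astep.
have xr : norm x < r.
  by apply: le_lt_trans dr; have := xa 0%N; rewrite subr0 expr0 mulr1.
exists x => //.
suff tx : t x = 0.
  have : uexp (- x) * uexp x = 1 by rewrite -uexpD ?normN // addNr uexp0.
  move: tx => /eqP; rewrite subr_eq0 => /eqP tx ex.
  by rewrite -[LHS]mul1r -tx -mulrA ex mulr1.
apply: (small_eq0 (c := d) c01) => n.
have [an tn] := aP n.
have anr : norm (a n) < r by rewrite (le_lt_trans an).
have dn : norm (a n - x) < r.
  rewrite norm_distC (le_lt_trans (xa n)) // (le_lt_trans _ dr) //.
  by rewrite ler_piMr.
(* This identity replaces continuity of [t]: with u exp(-x) = (1 + t(a_n)) exp(a_n - x), both
   summands are bounded by d c^n, so [t x] vanishes. *)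
have -> : t x = t (a n) * uexp (a n - x) + (uexp (a n - x) - 1).
  have ex : uexp (- x) = uexp (- a n) * uexp (a n - x).
    by rewrite -uexpD ?normN // addKr.
  by rewrite /t ex; ring.
rewrite norm_tri //.
  by rewrite normM -[d * _]mulr1 ler_pM // norm_uexp_le.
by rewrite uexp_sub1 // norm_distC.
Qed.

End UltrametricExp.

(** * The abstract exponential specialized to the p-adic numbers *)

Section PadicExp.
Variables (R : realType) (p : nat) (p_pr : prime p).
Implicit Types (x y : 'Q_[p_pr]).
Local Notation norm := (@padic_norm R p p_pr).
Local Notation dom := (@padic_exp_dom R p p_pr).
Local Notation exp_p := (@padic_exp R p p_pr).

Lemma padic_norm_natE n : (0 < n)%N -> norm n%:R = p%:R ^- logn p n.
Proof.
move=> n0; rewrite padic_norm_nat /padic_abs pnatr_eq0 gtn_eqF //.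
rewrite /padic_val -[n%:R]/((n%:Z)%:~R) numq_int denq_int logn1 subr0.
by rewrite -exprnN fmorphV rmorphXn /= ratr_int.
Qed.

Lemma padic_exp_domD x y : dom x -> dom y -> dom (x + y).
Proof.
rewrite /padic_exp_dom /= => xr yr.
by rewrite (le_lt_trans (padic_normD _ _ _)) // gt_max xr.
Qed.

Lemma padic_exp_dom0 : dom 0.
Proof.
by rewrite /padic_exp_dom /= padic_norm0 powR_gt0 // ltr0n prime_gt0.
Qed.

Lemma padic_exp_sub1 x : dom x -> norm (exp_p x - 1) = norm x.
Proof.
exact: (@uexp_sub1 R p _ norm p_pr (@padic_norm_ge0 _ _ _)
  (@padic_norm_eq0 _ _ _) (@padic_norm1 _ _ _) (@padic_normN _ _ _)
  (@padic_normM _ _ _) (@padic_normD _ _ _) padic_norm_natE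
  (@padic_complete _ _ _)).
Qed.

Lemma padic_exp0 : exp_p 0 = 1.
Proof.
exact: (@uexp0 R p _ norm p_pr (@padic_norm_ge0 _ _ _)
  (@padic_norm_eq0 _ _ _) (@padic_norm1 _ _ _) (@padic_normN _ _ _)
  (@padic_normM _ _ _) (@padic_normD _ _ _) padic_norm_natE
  (@padic_complete _ _ _)).
Qed.

Lemma padic_expD x y : dom x -> dom y -> exp_p (x + y) = exp_p x * exp_p y.
Proof.
exact: (@uexpD R p _ norm p_pr (@padic_norm_ge0 _ _ _)
  (@padic_norm_eq0 _ _ _) (@padic_norm1 _ _ _) (@padic_normN _ _ _)
  (@padic_normM _ _ _) (@padic_normD _ _ _) padic_norm_natE
  (@padic_complete _ _ _)).
Qed.

Lemma padic_exp_surj u : dom (u - 1) -> exists2 x, dom x & exp_p x = u.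
Proof.
exact: (@uexp_surj R p _ norm p_pr (@padic_norm_ge0 _ _ _)
  (@padic_norm_eq0 _ _ _) (@padic_norm1 _ _ _) (@padic_normN _ _ _)
  (@padic_normM _ _ _) (@padic_normD _ _ _) padic_norm_natE
  (@padic_complete _ _ _)).
Qed.

Lemma padic_exp_dom_lt1 x : dom x -> norm x < 1.
Proof.
rewrite /padic_exp_dom /= => /lt_le_trans; apply.
rewrite -[leRHS](powRr0 p%:R) ler_powR ?oppr_le0 ?invr_ge0 //.
by rewrite ler1n prime_gt0.
Qed.

Lemma padic_exp_neq0 x : dom x -> exp_p x != 0.
Proof.
move=> xd; apply/eqP => e0; have := padic_exp_sub1 xd.
rewrite e0 sub0r padic_normN padic_norm1 => n1.
by have := padic_exp_dom_lt1 xd; rewrite -n1 ltxx.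
Qed.

(** The two conclusions go through one induction, because multiplicativity at each step requires the
    partial sum to lie in the domain. *)
Lemma padic_exp_sum (I : Type) (s : seq I) (P : pred I) (F : I -> 'Q_[p_pr]) :
  (forall i, P i -> dom (F i)) ->
  dom (\sum_(i <- s | P i) F i) /\
  exp_p (\sum_(i <- s | P i) F i) = \prod_(i <- s | P i) exp_p (F i).
Proof.
move=> Fd; elim/big_rec2: _ => [|i y x Pi [xd <-]].
  by split; [exact: padic_exp_dom0 | exact: padic_exp0].
by split; [apply: padic_exp_domD | rewrite padic_expD]; auto.
Qed.

(** On rationals the nonzero norms are integral powers of p, so there is a gap between 1/p and 1.
    This upgrades the strict inequality of case b to the bound 1/p that the exponential domain calls
    for. *)
Lemma padic_norm_rat_lt1 (a : rat) :
  norm (padic_of_rat p_pr a) < 1 -> norm (padic_of_rat p_pr a) <= p%:R^-1.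
Proof.
rewrite padic_norm_rat /padic_abs; case: eqP => [_|_].
  by rewrite rmorph0 invr_ge0 ler0n.
have p1 : 1 < p%:Q by rewrite ltr1n prime_gt1.
rewrite -{1}(rmorph1 (@ratr R)) ltr_rat -{2}(expr0z p%:Q) ltr_eXz2l //.
move=> v1; rewrite -(ratr_nat R) -fmorphV ler_rat -[_^-1]/(p%:Q ^ (- 1)).
by rewrite ler_eXz2l //; lia.
Qed.

End PadicExp.

(** * Geometry of the Cayley tree *)

Section TreeGeometry.
Variables (k : nat) (T : cayley_tree k).
Implicit Types (x y z : T) (s : seq T).
Local Notation o := (Defs.root T).
Local Notation d x := (tree_dist x o).
Local Notation adj := (@Defs.adj k T).

Lemma dist_path x : exists s, [/\ path adj x s, last x s = o & size s = d x].
Proof. by rewrite /tree_dist; case: ex_minnP => n /asboolP. Qed.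

Lemma dist_min x s : path adj x s -> last x s = o -> (d x <= size s)%N.
Proof.
move=> xs so; rewrite /tree_dist; case: ex_minnP => n _; apply.
by apply/asboolP; exists s.
Qed.

Lemma dist_root : d o = 0%N.
Proof. by apply/eqP; rewrite -leqn0 (@dist_min o [::]). Qed.

Lemma dist_eq0 x : (d x == 0%N) = (x == o).
Proof.
apply/eqP/eqP => [x0|->]; last exact: dist_root.
have [s [_ so]] := dist_path x; rewrite x0 => /size0nil sE.
by rewrite sE in so.
Qed.

(** From any vertex on a shortest path the rest of the path is a strictly shorter way to the root.
    Consequently the path of a vertex no farther than x, other than x itself, avoids x. *)
Lemma geodesic x : exists s,
  [/\ path adj x s, last x s = o, size s = d x & all (fun z => d z < d x)%N s].
Proof.
have [s [xs so sx]] := dist_path x; exists s; split=> //; apply/allP => z zs.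
case/splitPr: zs xs so sx => s1 s2.
rewrite cat_path last_cat size_cat /= => /and3P[_ _ zs2] s2o <-.
by rewrite (leq_ltn_trans (dist_min zs2 s2o)) // addnS ltnS leq_addl.
Qed.

(* Otherwise the paths from a and b to the root, which avoid x, close up to a cycle. *)
Lemma adj_closer_unique x a b : adj x a -> adj x b ->
  (d a <= d x)%N -> (d b <= d x)%N -> a = b.
Proof.
move=> xa xb ax bx; apply: contrapT => /eqP ab.
have nx y : adj x y -> (d y <= d x)%N -> exists s,
    [/\ path adj y s, last y s = o & x \notin y :: s].
  move=> xy yx; have [s [ys so _ /allP sy]] := geodesic y; exists s; split=> //.
  rewrite inE negb_or; apply/andP; split.
    by apply: contraTneq xy => ->; rewrite adj_irr.
  by apply/negP => /sy; rewrite ltnNge yx.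
have [s [as_ so xs]] := nx a xa ax; have [t [bt to xt]] := nx b xb bx.
pose c := s ++ rev (belast b t).
have ac : path adj a c.
  rewrite cat_path as_ so -to rev_path /=.
  by rewrite (eq_path (e' := adj)) // => y z; rewrite adj_sym.
have cb : last a c = b.
  rewrite last_cat so -to; case: (t) => //= z u.
  by rewrite rev_cons last_rcons.
have xc : x \notin a :: c.
  rewrite -cat_cons mem_cat negb_or xs /= mem_rev.
  by apply: contra xt => /mem_belast.
case/shortenP: ac cb => e ae ue ec eb.
have xe : x \notin a :: e.
  apply: contra xc; rewrite !inE => /orP[->//|/ec ->]; exact: orbT.
have := @Defs.adj_acyclic k T (x :: a :: e); rewrite cons_uniq xe ue.
rewrite /= xa rcons_path ae eb adj_sym xb /=.
case: e eb {ae ue ec xe} => [/= E|y e _ /(_ isT isT) //].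
by rewrite E eqxx in ab.
Qed.

Lemma parent_ex x : x != o -> exists y, adj x y /\ d x = (d y).+1.
Proof.
move=> xo; have [[|y s] [/=]] := dist_path x.
  by move=> _ xE; rewrite xE eqxx in xo.
move=> /andP[xy ys] so sx; exists y; split=> //; apply/eqP; rewrite eqn_leq.
rewrite -{2}sx ltnS (dist_min ys) // andbT.
have [t [yt to ty]] := dist_path y.
by rewrite -ty -[(size t).+1]/(size (y :: t)) (@dist_min x (y :: t)) //= xy.
Qed.

(* The root is its own parent, by the default value of [xget]. *)
Definition parent x : T := xget x [set y | adj x y /\ d x = (d y).+1].

Lemma parentP x : x != o -> adj x (parent x) /\ d x = (d (parent x)).+1.
Proof.
by move=> /parent_ex[y xy]; rewrite /parent; case: xgetP => [z _ //|/(_ y)].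
Qed.

Lemma parent_root : parent o = o.
Proof. by rewrite /parent; case: xgetP => // z _ [_]; rewrite dist_root. Qed.

Lemma parent_unique x y : adj x y -> (d y <= d x)%N -> x != o /\ y = parent x.
Proof.
move=> xy yx; have xo : x != o.
  apply: contraTneq xy => xE; move: yx; rewrite xE dist_root leqn0 dist_eq0.
  by move=> /eqP->; rewrite adj_irr.
split=> //; have [xp dp] := parentP xo.
by apply: (adj_closer_unique xy xp) => //; rewrite dp.
Qed.

Lemma dist_child x y : y != o -> parent y = x -> d y = (d x).+1.
Proof. by move=> yo <-; have [] := parentP yo. Qed.

Definition neighbours x : seq T := projT1 (cid (adj_regular x)).

Definition children x : seq T := [seq y <- neighbours x | y != parent x].

Lemma mem_neighbours x y : (y \in neighbours x) = adj x y.
Proof.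
by rewrite /neighbours; case: cid => s /= [_ _ sx]; rewrite sx -topredE.
Qed.

Lemma children_uniq x : uniq (children x).
Proof.
by rewrite filter_uniq // /neighbours; case: cid => s /= [].
Qed.

Lemma mem_children x y : (y \in children x) = (y != o) && (parent y == x).
Proof.
rewrite mem_filter mem_neighbours; apply/andP/andP => [[yx xy]|[yo /eqP <-]].
  have [dyx|/ltnW dxy] := leqP (d y) (d x).
    by have [_ E] := parent_unique xy dyx; rewrite E eqxx in yx.
  move: xy; rewrite adj_sym => xy.
  by have [-> <-] := parent_unique xy dxy.
have [yp dy] := parentP yo; rewrite adj_sym; split=> //.
apply/eqP => yE; have [po|po] := eqVneq (parent y) o.
  by rewrite po parent_root in yE; rewrite yE eqxx in yo.
have [_] := parentP po; rewrite -yE => dp.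
by move: dy; rewrite dp; apply/eqP; rewrite neq_ltn ltnS leqnSn.
Qed.

Lemma size_children_root : size (children o) = k.+1.
Proof.
rewrite /children (@eq_in_filter _ _ predT) => [|y].
  by rewrite filter_predT /neighbours; case: cid => s /= [].
rewrite mem_neighbours => oy /=; apply: contraTneq oy => ->.
by rewrite parent_root adj_irr.
Qed.

Lemma size_children x : x != o -> size (children x) = k.
Proof.
move=> xo; have [xp _] := parentP xo.
have px : parent x \in neighbours x by rewrite mem_neighbours.
rewrite /children -rem_filter; last by rewrite /neighbours; case: cid => s /= [].
by rewrite size_rem //; rewrite /neighbours; case: cid => s /= [_ -> _].
Qed.

Lemma child_in_sphere n x y : y \in children x ->
  (y \in sphere T n.+1) = (x \in sphere T n).
Proof.
rewrite mem_children => /andP[yo /eqP yx].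
by rewrite !in_sphere (dist_child yo yx) eqSS.
Qed.

Lemma sphereS_parent n y : y \in sphere T n.+1 ->
  y != o /\ parent y \in sphere T n.
Proof.
move=> yn; have yo : y != o.
  by move: yn; rewrite in_sphere -dist_eq0 => /eqP->.
by rewrite -(@child_in_sphere n (parent y) y) // mem_children yo eqxx.
Qed.

Lemma tball_parent n y : y != o -> y \in tball T n -> parent y \in tball T n.
Proof.
by rewrite !in_tball => yo; have [_ ->] := parentP yo; apply: ltnW.
Qed.

Lemma sphere0 : sphere T 0 = [fset o]%fset.
Proof. by apply/fsetP => x; rewrite in_sphere inE dist_eq0. Qed.

Lemma tball0 : tball T 0 = [fset o]%fset.
Proof. by apply/fsetP => x; rewrite in_tball inE leqn0 dist_eq0. Qed.

Lemma perm_tballS n :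
  perm_eq (tball T n.+1) (enum_fset (tball T n) ++ enum_fset (sphere T n.+1)).
Proof.
apply: uniq_perm => [||x]; first exact: fset_uniq.
  rewrite cat_uniq !fset_uniq andbT /=; apply/hasPn => x.
  by rewrite in_sphere in_tball => /eqP->; rewrite ltnn.
by rewrite mem_cat !in_tball in_sphere leq_eqVlt orbC ltnS.
Qed.

Lemma perm_children n x : x \in sphere T n ->
  perm_eq [seq y <- sphere T n.+1 | parent y == x] (children x).
Proof.
move=> xn; apply: uniq_perm => [||y]; rewrite ?children_uniq ?filter_uniq ?fset_uniq //.
rewrite mem_filter mem_children; apply/andP/andP => [[-> yn]|[yo yx]].
  by have [] := sphereS_parent yn.
by split=> //; rewrite (@child_in_sphere n x) // mem_children yo.
Qed.

Lemma prod_sphereS (A : comPzSemiRingType) n (F : T -> A) :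
  \prod_(y <- sphere T n.+1) F y =
  \prod_(x <- sphere T n) \prod_(y <- children x) F y.
Proof.
(* Each y receives an inner product over the singleton of its parent, so that the two products can
   be exchanged and regrouped by parent. *)
transitivity (\prod_(y <- sphere T n.+1) \prod_(x <- sphere T n | parent y == x) F y).
  apply: eq_big_seq => y yn; have [_ py] := sphereS_parent yn.
  rewrite -big_filter (_ : [seq _ <- _ | _] = [:: parent y]) ?big_seq1 //.
  rewrite -(filter_pred1_uniq (fset_uniq (sphere T n)) py).
  by apply: eq_filter => x; rewrite /= eq_sym.
rewrite (exchange_big_dep predT) //=; apply: eq_big_seq => x xn.
by rewrite -(perm_big _ (perm_children xn)) big_filter.
Qed.

End TreeGeometry.

(** * Boundary laws and their Gibbs measures *)

Section Extension.
Variables (K : choiceType) (q : nat) (i0 : 'I_q).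
Implicit Types (L : {fset K}).

(** Finite configurations become functions on all of [K], with the spin [i0] outside [L], so that
    configurations on different balls can be compared without membership proofs. *)
Definition conf_ext L (s : {ffun L -> 'I_q}) (x : K) : 'I_q :=
  oapp s i0 (insub x).

Lemma conf_ext_val L (s : {ffun L -> 'I_q}) (v : L) : conf_ext s (val v) = s v.
Proof. by rewrite /conf_ext valK. Qed.

End Extension.

Section Weights.
Variables (R : realType) (p : nat) (p_pr : prime p).
Variables (k : nat) (T : cayley_tree k) (q : nat) (i0 : 'I_q) (J : 'Q_[p_pr]).
Hypothesis Jdom : padic_exp_dom R J.
Local Notation Qp := 'Q_[p_pr].
Local Notation o := (Defs.root T).
Local Notation exp_p := (padic_exp R).
Local Notation V := (tball T).
Local Notation W := (sphere T).
Implicit Types (t : T -> 'I_q).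

Lemma restr_conf_ext (L : {fset T}) (s : conf q L) : restr L (conf_ext i0 s) = s.
Proof. by apply/ffunP => v; rewrite ffunE conf_ext_val. Qed.

(** An edge is encoded by its endpoint farther from the root. At the root, which is its own parent,
    the set degenerates to a singleton, hence the condition [val v != o] wherever edges are
    enumerated. *)
Definition parent_edge n (v : V n) : {set V n} :=
  [set v; insubd v (parent (val v))]%SET.

Lemma val_parent_vertex n (v : V n) : val v != o ->
  val (insubd v (parent (val v))) = parent (val v).
Proof. by move=> vo; rewrite insubdK //; apply: tball_parent (valP v). Qed.

Lemma edgesE n : edges T n = [set parent_edge v | v in [set v | val v != o]]%SET.
Proof.
have H (a b : V n) : adj (val a) (val b) ->
    (tree_dist (val b) o <= tree_dist (val a) o)%N ->
    val a != o /\ parent_edge a = [set a; b]%SET.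
  move=> ab ba; have [ao bE] := parent_unique ab ba; split=> //.
  congr ([set _; _]%SET); apply: val_inj; rewrite val_parent_vertex //.
apply/setP => e; apply/imsetP/imsetP => [[[a b]]|[v]]; rewrite !inE /=.
  move=> ab ->; have [ba|/ltnW ba] := leqP (tree_dist (val b) o) (tree_dist (val a) o).
    by have [ao <-] := H a b ab ba; exists a; rewrite ?inE.
  rewrite adj_sym in ab; have [bo E] := H b a ab ba.
  by exists b; rewrite ?inE // E finset.setUC.
move=> vo ->; exists (v, insubd v (parent (val v))); rewrite ?inE //=.
by rewrite val_parent_vertex //; have [] := parentP vo.
Qed.

(** Two distinct vertices with the same edge would be parents of each other, and each would be
    farther from the root than the other. *)
Lemma parent_edge_inj n :
  {in [set v : V n | val v != o]%SET &, injective (@parent_edge n)}.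
Proof.
move=> v w; rewrite !inE => vo wo E.
have : v \in parent_edge w by rewrite -E !inE eqxx.
have : w \in parent_edge v by rewrite E !inE eqxx.
rewrite !inE => /orP[/eqP->//|/eqP wE] /orP[/eqP->//|/eqP vE].
have [_ dv] := parentP vo; have [_ dw] := parentP wo.
have := val_parent_vertex vo; have := val_parent_vertex wo.
by rewrite -wE -vE => pw pv; rewrite -pv in dv; rewrite -pw in dw; lia.
Qed.

Lemma hamiltonian_restr n t : hamiltonian J (restr (V n) t) =
  \sum_(x <- V n | x != o) J * (t x == t (parent x))%:R.
Proof.
rewrite /hamiltonian mulr_sumr edgesE big_imset /=; last exact: parent_edge_inj.
rewrite big_seq_fsetE /=; apply: eq_big => v; first by rewrite inE.
rewrite inE => vo; congr (_ * (_ : bool)%:R).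
have pv := val_parent_vertex vo.
apply/forall_inP/eqP => [H|E x].
  have := H v; rewrite !inE eqxx => /(_ isT)/forall_inP.
  move=> /(_ (insubd v (parent (val v)))); rewrite !inE eqxx orbT.
  by move=> /(_ isT)/eqP; rewrite !ffunE pv.
rewrite !inE => xv; apply/forall_inP => y; rewrite !inE !ffunE => yv.
by case/orP: xv => /eqP->; case/orP: yv => /eqP->; rewrite ?pv ?E.
Qed.

Section BoundaryField.
Variable h : T -> 'I_q -> Qp.
Hypothesis hdom : forall x i, padic_exp_dom R (h x i).

Definition bond (i j : 'I_q) : Qp := if i == j then exp_p J else 1.

Definition prod_weight n t : Qp :=
  (\prod_(x <- V n | x != o) bond (t x) (t (parent x))) *
  \prod_(x <- W n) exp_p (h x (t x)).

Lemma weight_restr n t : weight R J h (restr (V n) t) = prod_weight n t.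
Proof.
rewrite /weight hamiltonian_restr.
have -> : \sum_(x : V n | val x \in W n) h (val x) (restr (V n) t x) =
    \sum_(x <- W n) h x (t x).
  rewrite (eq_bigr (fun v : V n => h (val v) (t (val v)))) => [|v _]; last first.
    by rewrite ffunE.
  rewrite -(big_seq_fsetE _ _ (fun x => x \in W n) (fun x => h x (t x))) /=.
  rewrite -big_filter; apply: perm_big; apply: uniq_perm => [||x].
  - by rewrite filter_uniq ?fset_uniq.
  - exact: fset_uniq.
  rewrite mem_filter in_sphere in_tball andb_idr // => /eqP->.
  exact: leqnn.
have Jd x : padic_exp_dom R (J * (t x == t (parent x))%:R).
  by case: (_ == _); rewrite ?mulr1 ?mulr0 //; apply: padic_exp_dom0.
have [d1 e1] := @padic_exp_sum R p p_pr _ (V n) (fun x => x != o) _ (fun x _ => Jd x).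
have [d2 e2] := @padic_exp_sum R p p_pr _ (W n) predT _ (fun x _ => hdom x (t x)).
rewrite padic_expD // e1 e2; congr (_ * _); apply: eq_bigr => x _.
by rewrite /bond; case: (_ == _); rewrite ?mulr1 ?mulr0 ?padic_exp0.
Qed.

Lemma weight_ext n (s : conf q (V n)) :
  weight R J h s = prod_weight n (conf_ext i0 s).
Proof. by rewrite -weight_restr restr_conf_ext. Qed.

Lemma conf_ext_concat n (s : conf q (V n)) (w : conf q (W n.+1)) x :
  conf_ext i0 (concat s w) x =
  if x \in V n then conf_ext i0 s x else conf_ext i0 w x.
Proof.
have [xV|xV] := boolP (x \in V n); last have [xW|xW] := boolP (x \in W n.+1).
- have xV' : x \in V n.+1 by move: xV; rewrite !in_tball => /leqW.
  rewrite -[x]/(val [` xV']%fset) conf_ext_val ffunE /=.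
  case: {-}_ / boolP => [xV2|xV2]; last by case/negP: (xV2).
  exact: esym (conf_ext_val i0 s [` xV2]%fset).
- have xV' : x \in V n.+1 by move: xW; rewrite in_sphere in_tball => /eqP->.
  rewrite -[x]/(val [` xV']%fset) conf_ext_val ffunE /=.
  case: {-}_ / boolP => [xV2|xV2]; first by case/negP: xV.
  exact: esym (conf_ext_val i0 w [` tball_sphere _ xV2]%fset).
have xV' : x \notin V n.+1.
  by apply: contra xW => /tball_sphere; apply.
by rewrite /conf_ext !insubN.
Qed.

End BoundaryField.
End Weights.

Section BoundaryLaw.
Variables (R : realType) (p : nat) (p_pr : prime p).
Variables (k : nat) (T : cayley_tree k) (q : nat) (i0 : 'I_q) (J : 'Q_[p_pr]).
Hypothesis Jdom : padic_exp_dom R J.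
Local Notation Qp := 'Q_[p_pr].
Local Notation o := (Defs.root T).
Local Notation exp_p := (padic_exp R).
Local Notation V := (tball T).
Local Notation W := (sphere T).
Local Notation bond := (bond R J).
Variables (h : T -> 'I_q -> Qp) (c : T -> Qp).
Hypothesis hdom : forall x i, padic_exp_dom R (h x i).
Hypothesis law : forall x i,
  \prod_(y <- children x) \sum_j bond j i * exp_p (h y j) = c x * exp_p (h x i).
Hypothesis c_neq0 : forall x, c x != 0.
Hypothesis root_sum_neq0 : \sum_i exp_p (h o i) != 0.

Local Notation w8 := (weight R J h).
Local Notation Z := (partition_fun R J h).

Let cW n := \prod_(x <- W n) c x.

(** Once [s] is fixed, the spins on the next sphere interact only with their parents, so the sum
    over [w] factors into one-spin sums; grouped by parent, these are the left-hand sides of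
    [law]. *)
Lemma sum_weight_concat n (s : conf q (V n)) :
  \sum_(w : conf q (W n.+1)) w8 (concat s w) = cW n * w8 s.
Proof.
pose t := conf_ext i0 s.
pose G (y : T) (j : 'I_q) := bond j (t (parent y)) * exp_p (h y j).
pose B := \prod_(x <- V n | x != o) bond (t x) (t (parent x)).
have E (w : conf q (W n.+1)) :
    w8 (concat s w) = B * \prod_(y : W n.+1) G (val y) (w y).
  rewrite (weight_ext i0 Jdom hdom) /prod_weight (perm_big _ (perm_tballS T n)) /=.
  rewrite big_cat /= -mulrA; congr (_ * _).
    rewrite big_seq_cond [RHS]big_seq_cond; apply: eq_bigr => x /andP[xV xo].
    by rewrite !conf_ext_concat xV tball_parent.
  rewrite [X in X * _]big_seq_cond.
  rewrite [X in X * _](eq_bigl (fun x => x \in W n.+1)) => [|x]; last first.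
    by rewrite andb_idr // => xW; have [] := sphereS_parent xW.
  rewrite -big_seq -big_split /= big_seq_fsetE /=; apply: eq_bigr => y _.
  have [yo pV] := sphereS_parent (valP y).
  have yV : val y \notin V n.
    by have := valP y; rewrite in_sphere in_tball => /eqP->; rewrite ltnn.
  have pV' : parent (val y) \in V n.
    by move: pV; rewrite in_sphere in_tball => /eqP->.
  by rewrite !conf_ext_concat (negPf yV) pV' conf_ext_val.
under eq_bigr do rewrite E.
rewrite -mulr_sumr.
rewrite -(bigA_distr_bigA (fun (y : W n.+1) j => G (val y) j)) /=.
rewrite -(big_seq_fsetE _ (W n.+1) predT (fun y => \sum_j G y j)) /= prod_sphereS.
have -> : \prod_(x <- W n) \prod_(y <- children x) \sum_j G y j =
    \prod_(x <- W n) (c x * exp_p (h x (t x))).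
  apply: eq_bigr => x _; rewrite -law; apply: eq_big_seq => y.
  by rewrite mem_children => /andP[_ /eqP <-].
by rewrite big_split /= mulrCA (weight_ext i0 Jdom hdom).
Qed.

Lemma sum_confS n (F : conf q (V n.+1) -> Qp) :
  \sum_s F s = \sum_(s : conf q (V n)) \sum_(w : conf q (W n.+1)) F (concat s w).
Proof.
rewrite pair_big /=.
pose f (sw : conf q (V n) * conf q (W n.+1)) := concat sw.1 sw.2.
pose g (s : conf q (V n.+1)) :=
  (restr (V n) (conf_ext i0 s), restr (W n.+1) (conf_ext i0 s)).
rewrite (reindex f) //=; exists g => [[s w]|s] _; rewrite /f /g /=.
  congr pair; apply/ffunP => v; rewrite ffunE conf_ext_concat.
    by rewrite (valP v) conf_ext_val.
  have -> : (val v \in V n) = false.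
    by have := valP v; rewrite in_sphere in_tball => /eqP->; rewrite ltnn.
  exact: conf_ext_val.
apply/ffunP => v; rewrite -(conf_ext_val i0) conf_ext_concat.
have [vV|vV] := boolP (val v \in V n).
  by rewrite -[val v]/(val [` vV]%fset) conf_ext_val ffunE conf_ext_val.
have vW := tball_sphere (valP v) vV.
by rewrite -[val v]/(val [` vW]%fset) conf_ext_val ffunE conf_ext_val.
Qed.

Lemma partition_funS n : Z n.+1 = cW n * Z n.
Proof.
rewrite /partition_fun sum_confS mulr_sumr; apply: eq_bigr => s _.
exact: sum_weight_concat.
Qed.

Let cW_neq0 n : cW n != 0.
Proof. by rewrite prodf_seq_neq0; apply/allP => x _; apply/implyP. Qed.

Lemma partition_fun0 : Z 0 = \sum_i exp_p (h o i).
Proof.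
have oV : o \in V 0 by rewrite in_tball dist_root.
pose f (i : 'I_q) : conf q (V 0) := [ffun=> i].
rewrite /partition_fun (reindex f) /=; last first.
  exists (fun s : conf q (V 0) => s [` oV]%fset) => [i|s] _; rewrite /f ?ffunE //.
  apply/ffunP => v; rewrite ffunE; congr (s _); apply: val_inj => /=.
  by have := valP v; rewrite in_tball leqn0 dist_eq0 => /eqP->.
apply: eq_bigr => i _.
have -> : f i = restr (V 0) (fun=> i) by apply/ffunP => v; rewrite !ffunE.
rewrite weight_restr // /prod_weight sphere0 tball0 big_mkcond /= !big_seq_fset1.
by rewrite eqxx mul1r.
Qed.

(** Each enlargement of the ball multiplies the partition function by the nonzero constants [c x] of
    the outer sphere, so only the sum at the root has to be checked. *)
Lemma partition_fun_neq0 n : Z n != 0.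
Proof.
elim: n => [|n IHn]; first by rewrite partition_fun0.
by rewrite partition_funS mulf_neq0.
Qed.

Lemma law_compatible : compatible R J h.
Proof.
move=> n s; rewrite /gibbs_fin -mulr_sumr sum_weight_concat partition_funS.
by rewrite invfM mulrACA mulVf // mul1r.
Qed.

End BoundaryLaw.

(** * From compatible finite-volume weights to a measure on the cylinder algebra *)

Section GibbsExtension.
Variables (R : realType) (p : nat) (p_pr : prime p).
Variables (k : nat) (T : cayley_tree k) (q : nat) (i0 : 'I_q) (J : 'Q_[p_pr]).
Local Notation Qp := 'Q_[p_pr].
Local Notation V := (tball T).
Local Notation W := (sphere T).
Variable h : T -> 'I_q -> Qp.
Hypothesis hdom : forall x i, padic_exp_dom R (h x i).
Hypothesis Z_neq0 : forall n, partition_fun R J h n != 0.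
Hypothesis comp : compatible R J h.

Local Notation ext := (conf_ext i0).

(** A member of the cylinder algebra has many presentations by a radius and a set of configurations;
    this property of the radius alone is monotone in [n], so sets can be brought to a common
    radius. *)
Definition depends_on_ball n (A : set (T -> 'I_q)) : Prop :=
  forall s t, restr (V n) s = restr (V n) t -> A s -> A t.

Lemma cylinder_algebra_depends (A : set (T -> 'I_q)) :
  cylinder_algebra A -> exists n, depends_on_ball n A.
Proof. by move=> [n [B ->]]; exists n => s t /= ->. Qed.

Lemma depends_on_ballW n m A : (n <= m)%N ->
  depends_on_ball n A -> depends_on_ball m A.
Proof.
move=> nm An s t st; apply: An; apply/ffunP => v; rewrite !ffunE.
have vV : val v \in V m by move: (valP v); rewrite !in_tball => /leq_trans; apply.
by have /ffunP/(_ [` vV]%fset) := st; rewrite !ffunE.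
Qed.

(* Meaningful only when A depends on the ball of radius n: configurations are
   extended by the arbitrary spin [i0]. *)
Definition ball_mass n (A : set (T -> 'I_q)) : Qp :=
  \sum_(s : conf q (V n) | `[< A (ext s) >]) gibbs_fin R J h s.

Lemma ball_massS n A : depends_on_ball n A -> ball_mass n.+1 A = ball_mass n A.
Proof.
move=> An; rewrite /ball_mass big_mkcond sum_confS // [RHS]big_mkcond /=.
apply: eq_bigr => s _; rewrite -comp.
have E (w : conf q (W n.+1)) : `[< A (ext (concat s w)) >] = `[< A (ext s) >].
  have rE : restr (V n) (ext (concat s w)) = restr (V n) (ext s).
    by apply/ffunP => v; rewrite !ffunE conf_ext_concat (valP v).
  by apply/asboolP/asboolP; apply: An.
under eq_bigr do rewrite E.
by case: asbool => //; rewrite big1.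
Qed.

Lemma ball_mass_eq n m A : depends_on_ball n A -> depends_on_ball m A ->
  ball_mass n A = ball_mass m A.
Proof.
have H l j : depends_on_ball l A -> ball_mass (j + l) A = ball_mass l A.
  move=> Al; elim: j => // j IHj; rewrite addSn ball_massS //.
  exact: depends_on_ballW (leq_addl _ _) Al.
by move=> /(H n m) <- /(H m n) <-; rewrite addnC.
Qed.

(** The radius is an arbitrary one supplied by choice; [ball_mass_eq], which rests on compatibility,
    makes the value independent of it. *)
Definition limit_measure (A : @cylinder_algebra k T q) : Qp :=
  ball_mass (projT1 (cid (cylinder_algebra_depends (set_valP A)))) (val A).

Lemma limit_measureE n (A : @cylinder_algebra k T q) :
  depends_on_ball n (val A) -> limit_measure A = ball_mass n (val A).
Proof.
by rewrite /limit_measure; case: cid => m /= Am An; apply: ball_mass_eq.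
Qed.

Lemma limit_measure_cylinder n (s : conf q (V n)) (A : @cylinder_algebra k T q) :
  val A = cylinder s -> limit_measure A = gibbs_fin R J h s.
Proof.
move=> As; rewrite (@limit_measureE n) As; last first.
  by move=> u v; rewrite /cylinder /= => ->.
rewrite /ball_mass (big_pred1 s) // => s'.
by rewrite /cylinder /= restr_conf_ext; apply/asboolP/eqP.
Qed.

Lemma limit_measure_gibbs : gibbs_measures R T q J limit_measure.
Proof.
split; last by exists h; split=> // n s A; apply: limit_measure_cylinder.
split=> [A B C AB CE|A AE].
  have [a Aa] := cylinder_algebra_depends (set_valP A).
  have [b Bb] := cylinder_algebra_depends (set_valP B).
  have [c Cc] := cylinder_algebra_depends (set_valP C).
  pose n := (a + b + c)%N.
  rewrite !(@limit_measureE n).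
  - rewrite CE /ball_mass (bigID (fun s => `[< val A (ext s) >])) /=.
    congr (_ + _); apply: eq_bigl => s; apply/andP/asboolP => [].
    + by move=> [/asboolP ? /asboolP].
    + by move=> As; split; apply/asboolP => //; left.
    + by move=> [/asboolP[As|//] /asboolP nAs]; case: nAs.
    + move=> Bs; split; first by apply/asboolP; right.
      apply/asboolP => As; have : (val A `&` val B) (ext s) by [].
      by rewrite AB.
  - by apply: depends_on_ballW Bb; rewrite /n; lia.
  - by apply: depends_on_ballW Aa; rewrite /n; lia.
  - by apply: depends_on_ballW Cc; rewrite /n; lia.
rewrite (@limit_measureE 0) AE // /ball_mass.
rewrite (eq_bigl predT) => [|s]; last by apply/asboolP.
by rewrite -mulr_sumr mulVf.
Qed.

Lemma exists_gibbs_measure : exists2 mu, gibbs_measures R T q J mu &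
  forall n (s : conf q (V n)) (A : @cylinder_algebra k T q),
    val A = cylinder s -> mu A = gibbs_fin R J h s.
Proof.
by exists limit_measure; [exact: limit_measure_gibbs|exact: limit_measure_cylinder].
Qed.

End GibbsExtension.

(** Dividing the two equations cancels every normalization and leaves u/v = u'/v'. In the
    application [z] and [z'] are inverse partition functions, [b] and [c] bond products, [e] and
    [e'] the factors of the other boundary vertices. *)
Lemma cross_ratio (K : fieldType) (z z' b c e e' u u' v v' : K) :
  z != 0 -> z' != 0 -> b != 0 -> c != 0 -> e != 0 -> e' != 0 ->
  z * (b * (u * e)) = z' * (b * (u' * e')) ->
  z * (c * (v * e)) = z' * (c * (v' * e')) -> u * v' = v * u'.
Proof.
move=> z0 z0' b0 c0 e0 e0' E1 E2.
have d0 : (z * b * e) * (z' * c * e') != 0 by rewrite !mulf_neq0.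
apply: (mulfI d0); transitivity ((z * (b * (u * e))) * (z' * (c * (v' * e')))).
  by ring.
by rewrite E1 -E2; ring.
Qed.

(** * Recovering a boundary law, up to a scalar, from the finite-volume weights *)

Section LawDetermined.
Variables (R : realType) (p : nat) (p_pr : prime p).
Variables (k : nat) (T : cayley_tree k) (q : nat) (i0 : 'I_q) (J : 'Q_[p_pr]).
Hypothesis Jdom : padic_exp_dom R J.
Local Notation exp_p := (padic_exp R).
Variables h h' : T -> 'I_q -> 'Q_[p_pr].
Hypothesis hdom : forall x i, padic_exp_dom R (h x i).
Hypothesis hdom' : forall x i, padic_exp_dom R (h' x i).
Hypothesis Z_neq0 : forall n, partition_fun R J h n != 0.
Hypothesis Z_neq0' : forall n, partition_fun R J h' n != 0.

(** The test configurations carry [i0] everywhere except at [y]. Changing the spin at [y] alters the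
    boundary factor there and some bonds, and the bonds are the same for both fields, so the
    comparison isolates the ratio of the law at [y]. *)
Lemma gibbs_fin_determines n (y : T) i j : y \in sphere T n ->
  (forall s : conf q (tball T n), gibbs_fin R J h s = gibbs_fin R J h' s) ->
  exp_p (h y i) * exp_p (h' y j) = exp_p (h y j) * exp_p (h' y i).
Proof.
move=> yn hh'.
pose t (l : 'I_q) (x : T) := if x == y then l else i0.
pose Q (g : T -> 'I_q -> 'Q_[p_pr]) :=
  \prod_(x <- sphere T n | x != y) exp_p (g x i0).
have tE g l : \prod_(x <- sphere T n) exp_p (g x (t l x)) = exp_p (g y l) * Q g.
  rewrite (bigD1_seq y yn (fset_uniq _)).
  have -> : t l y = l by rewrite /t eqxx.
  have -> // : \prod_(x <- sphere T n | x != y) exp_p (g x (t l x)) = Q g.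
  by apply: eq_bigr => x /negPf xy; rewrite /t xy.
have Q0 g : (forall x i, padic_exp_dom R (g x i)) -> Q g != 0.
  move=> gd; rewrite prodf_seq_neq0; apply/allP => x _; apply/implyP => _.
  exact: padic_exp_neq0.
pose B l := \prod_(x <- tball T n | x != Defs.root T) bond R J (t l x) (t l (parent x)).
have B0 l : B l != 0.
  rewrite prodf_seq_neq0; apply/allP => x _; apply/implyP => _.
  by rewrite /bond; case: ifP => _; [exact: padic_exp_neq0 | exact: oner_neq0].
have wE g l : (forall x i, padic_exp_dom R (g x i)) ->
    weight R J g (restr (tball T n) (t l)) = B l * (exp_p (g y l) * Q g).
  by move=> gd; rewrite (weight_restr Jdom gd) /prod_weight tE.
have E l := hh' (restr (tball T n) (t l)).
rewrite /gibbs_fin in E; move: (E i) (E j); rewrite !(wE _ _ hdom) !(wE _ _ hdom').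
exact: (cross_ratio (invr_neq0 (Z_neq0 n)) (invr_neq0 (Z_neq0' n))
  (B0 i) (B0 j) (Q0 h hdom) (Q0 h' hdom')).
Qed.

End LawDetermined.

(** * Two-valued laws *)

Section TwoLevel.
Variables (K : fieldType) (q : nat).
Hypothesis char0 : forall n, (0 < n)%N -> n%:R != 0 :> K.

Definition two_level (A : {set 'I_q}) : 'I_q -> K :=
  fun i => if i \in A then 1 - q%:R / #|A|%:R else 1.

Lemma sum_set_const (A : {set 'I_q}) (a b : K) :
  \sum_i (if i \in A then a else b) = a *+ #|A| + b *+ (q - #|A|).
Proof.
rewrite (bigID (mem A)) /= (eq_bigr (fun=> a)) => [|i ->//].
rewrite [X in _ + X](eq_bigr (fun=> b)) => [|i /negPf->//].
rewrite !sumr_const; congr (_ *+ _ + _ *+ _).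
have := cardC (mem A); rewrite card_ord => E.
by rewrite -[X in (X - _)%N]E addKn.
Qed.

(** The bond weight at j = i subtracts q f(i)^3 from the full sum m x^3 + (q - m). Substituting q =
    m (1 - x) leaves m x (x^3 - 1) for i in A and m (x^3 - 1) otherwise. *)
Lemma two_level_law (A : {set 'I_q}) i : (0 < #|A|)%N ->
  \sum_j (if j == i then 1 - q%:R else 1) * two_level A j ^+ 3 =
  #|A|%:R * ((1 - q%:R / #|A|%:R) ^+ 3 - 1) * two_level A i.
Proof.
move=> A0; have m0 := char0 A0.
have Aq : (#|A| <= q)%N by rewrite -[q in leqRHS]card_ord max_card.
have sumE : \sum_j two_level A j ^+ 3 =
    #|A|%:R * (1 - q%:R / #|A|%:R) ^+ 3 + (q%:R - #|A|%:R).
  transitivity ((1 - q%:R / #|A|%:R) ^+ 3 *+ #|A| + 1 *+ (q - #|A|) : K).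
    rewrite -sum_set_const; apply: eq_bigr => j _.
    by rewrite /two_level; case: ifP; rewrite ?expr1n.
  by rewrite -natrB //; congr (_ + _); exact: esym (mulr_natl _ _).
rewrite (bigD1 i) //= eqxx.
rewrite (eq_bigr (fun j => two_level A j ^+ 3)) => [|j /negPf->]; last by rewrite mul1r.
move: sumE; rewrite (bigD1 i) //=; move: (\sum_(j | j != i) _) => S sumE.
have -> : S = #|A|%:R * (1 - q%:R / #|A|%:R) ^+ 3 + (q%:R - #|A|%:R) -
    two_level A i ^+ 3 by rewrite -sumE addrAC subrr add0r.
by rewrite /two_level; case: ifP => _; field.
Qed.

(** Since q - m = -m x, a sixth root of unity x would give (q - m)^6 = m^6 in the field, hence among
    natural numbers by characteristic zero, and so q - m = m. *)
Lemma two_level_ratio_neq1 m : (0 < m)%N -> (m < q)%N -> q <> (2 * m)%N ->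
  (1 - q%:R / m%:R : K) ^+ 6 != 1.
Proof.
move=> m0 mq q2m; have mK := char0 m0; apply/eqP => x1.
have nat_inj : injective (fun n : nat => n%:R : K).
  move=> a b; wlog ab : a b / (a <= b)%N.
    by move=> H; have [ab|/ltnW ab] := leqP a b => E; [|symmetry]; apply: H.
  move=> E; apply/eqP; rewrite eqn_leq ab -subn_eq0 -leqn0 leqNgt.
  by apply/negP => /char0; rewrite natrB // E subrr eqxx.
have : (q - m)%:R ^+ 6 = m%:R ^+ 6 :> K.
  rewrite natrB ?(ltnW mq) //.
  have -> : q%:R - m%:R = - (m%:R * (1 - q%:R / m%:R)) :> K by field.
  by rewrite exprNn exprMn x1; ring.
rewrite -!natrX => /nat_inj /eqP; rewrite eqn_exp2r // => /eqP; lia.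
Qed.

End TwoLevel.

Lemma half_ratio (K : fieldType) m : m%:R != 0 :> K ->
  1 - (2 * m)%:R / m%:R = -1 :> K.
Proof. by move=> m0; rewrite natrM; field. Qed.

(** * Norm estimates for the ratio in the three cases *)

Section Arithmetic.
Variables (R : realType) (p : nat) (p_pr : prime p).
Local Notation Qp := 'Q_[p_pr].
Local Notation norm := (@padic_norm R p p_pr).
Local Notation dom := (@padic_exp_dom R p p_pr).

Lemma padic_nat_neq0 n : (0 < n)%N -> n%:R != 0 :> Qp.
Proof.
move=> n0; rewrite -(padic_norm_eq0 R) padic_norm_natE // invr_eq0.
by rewrite expf_neq0 // pnatr_eq0 -lt0n prime_gt0.
Qed.

Lemma padic_exp_dom2 : p = 2%N -> forall x : Qp, dom x <-> norm x < 2^-1.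
Proof.
move=> p2 x; rewrite /padic_exp_dom /=.
suff -> : p%:R `^ (- p.-1%:R^-1) = 2^-1 :> R by [].
by rewrite p2 /= invr1 powR_inv1.
Qed.

(** For p > 2 the exponent 1/(p-1) is below 1, so 1/p is strictly inside the disc. At p = 2 it is
    exactly the excluded radius, whence the additional factor 2 in case a. *)
Lemma padic_exp_dom_odd (x : Qp) : p <> 2%N -> norm x <= p%:R^-1 -> dom x.
Proof.
move=> p2 xp; have p3 : (2 < p)%N.
  by rewrite ltn_neqAle prime_gt1 // andbT eq_sym; apply/eqP.
apply: le_lt_trans xp _; rewrite -[ltLHS]powR_inv1 // /powR gt_eqF ?ltr0n ?prime_gt0 //=.
rewrite ltr_expR ltr_pM2r ?ln_gt0 ?ltr1n ?prime_gt1 // ltrN2.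
by rewrite invf_lt1 ?ltr1n ?ltr0n; lia.
Qed.

Lemma padic_norm2_odd : p <> 2%N -> norm 2 = 1.
Proof.
move=> p2; rewrite -[2]/(2%:R) padic_norm_natE // lognE /= p_pr /=.
rewrite (_ : (p %| 2)%N = false) ?expr0 ?invr1 //.
by rewrite dvdn_prime2 //; apply/eqP.
Qed.

Lemma padic_norm2_even : p = 2%N -> norm 2 = 2^-1.
Proof. by move=> p2; rewrite -[2]/(2%:R) padic_norm_natE // p2. Qed.

(** The isometry property gives |q| = |J|, whereas |2| is 1 for odd p and equals the excluded radius
    1/2 for p = 2. For q = 2 the singleton ratio 1 - q would be -1, a sixth root of unity. *)
Lemma exp_nat_neq2 (J : Qp) q : dom J -> padic_exp R J = 1 - q%:R -> q <> 2%N.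
Proof.
move=> Jd Jq q2; have nJ := padic_exp_sub1 Jd.
rewrite Jq addrAC subrr add0r padic_normN q2 in nJ.
have [p2|p2] := eqVneq p 2%N.
  by move/(padic_exp_dom2 p2): Jd; rewrite -nJ padic_norm2_even // ltxx.
have := padic_exp_dom_lt1 Jd; rewrite -nJ padic_norm2_odd ?ltxx //.
exact/eqP.
Qed.

Lemma cubic_ratio q m : (0 < m)%N -> (0 < q)%N ->
  let x : Qp := 1 - q%:R / m%:R in
  [\/ p = 2%N /\ norm q%:R < norm (2 * m%:R),
      p <> 2%N /\ norm q%:R < norm m%:R |
      [/\ p <> 2%N, norm q%:R = norm m%:R & padic_eqmod R (x ^+ 2 + x + 1) 0]] ->
  dom (x ^+ 3 - 1) /\ q <> (2 * m)%N.
Proof.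
move=> m0 q0 x; have mK := padic_nat_neq0 m0.
have nm0 : 0 < norm m%:R by rewrite padic_norm_gt0.
have nx1 : norm (x - 1) = norm q%:R / norm m%:R.
  by rewrite /x addrAC subrr add0r padic_normN padic_normM padic_normV.
have factor : norm (x ^+ 3 - 1) = norm (x - 1) * norm (x ^+ 2 + x + 1).
  by rewrite -padic_normM; congr norm; ring.
have quad_le1 : norm (x - 1) <= 1 -> norm (x ^+ 2 + x + 1) <= 1.
  move=> x1; have xle : norm x <= 1.
    by rewrite -(subrK 1 x) (le_trans (padic_normD _ _ _)) // ge_max x1 padic_norm1 /=.
  rewrite (le_trans (padic_normD _ _ _)) // ge_max padic_norm1 lexx andbT.
  rewrite (le_trans (padic_normD _ _ _)) // ge_max xle andbT padic_normX.
  by rewrite exprn_ile1 // padic_norm_ge0.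
case=> [[p2 q2m]|[p2 qm]|[p2 qm [z z1 xz]]].
- split; last by move=> E; move: q2m; rewrite E natrM ltxx.
  have x1d : dom (x - 1).
    apply/(padic_exp_dom2 p2); rewrite nx1 ltr_pdivrMr //.
    by rewrite -(padic_norm2_even p2) -padic_normM.
  apply: le_lt_trans (x1d); rewrite factor ler_piMr ?padic_norm_ge0 //.
  by apply: quad_le1; apply/ltW/padic_exp_dom_lt1.
- split; last first.
    by move=> E; move: qm; rewrite E natrM padic_normM padic_norm2_odd // mul1r ltxx.
  apply: padic_exp_dom_odd => //; rewrite factor.
  have x1 : norm (x - 1) < 1 by rewrite nx1 ltr_pdivrMr // mul1r.
  have x1p : norm (x - 1) <= p%:R^-1.
    have xE : x - 1 = padic_of_rat p_pr (- (q%:R / m%:R)).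
      by rewrite rmorphN fmorph_div /= !rmorph_nat /x addrAC subrr add0r.
    by move: x1; rewrite xE; apply: padic_norm_rat_lt1.
  by rewrite (le_trans _ x1p) // ler_piMr ?padic_norm_ge0 // quad_le1 // ltW.
have nx : norm (x - 1) = 1 by rewrite nx1 qm divff ?gt_eqF.
have quad : norm (x ^+ 2 + x + 1) <= p%:R^-1.
  rewrite subr0 in xz; rewrite xz padic_normM padic_norm_natE ?prime_gt0 //.
  rewrite logn_prime // eqxx expr1 ler_piMr // invr_ge0 ler0n //.
split; first by apply: padic_exp_dom_odd => //; rewrite factor nx mul1r.
(* With q = 2m one has x = -1 and x^2 + x + 1 = 1, which is not divisible by p. *)
move=> E; have xN1 : x = -1.
  by rewrite /x E half_ratio.
move: quad; rewrite xN1 sqrrN expr1n subrK padic_norm1.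
by rewrite leNgt invf_lt1 ?ltr1n ?prime_gt1 ?ltr0n ?prime_gt0.
Qed.

End Arithmetic.

(** * Measures of two boundary types *)

Section TwoTypeMeasures.
Variables (R : realType) (p : nat) (p_pr : prime p).
Variables (T : cayley_tree 3) (q : nat) (J : 'Q_[p_pr]).
Hypothesis Jdom : padic_exp_dom R J.
Hypothesis Jq : padic_exp R J = 1 - q%:R.
Hypothesis q_neq2 : q <> 2%N.
Hypothesis q_gt1 : (1 < q)%N.
Local Notation Qp := 'Q_[p_pr].
Local Notation o := (Defs.root T).
Local Notation exp_p := (padic_exp R).
Local Notation dom := (@padic_exp_dom R p p_pr).
Local Notation level := (@two_level Qp q).

Let char0 := padic_nat_neq0 R p_pr.

Definition first_child : T := nth o (children o) 0.
Definition second_child : T := nth o (children o) 1.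

Lemma first_childP : first_child \in children o.
Proof. by rewrite mem_nth // size_children_root. Qed.

Lemma second_childP : second_child \in children o.
Proof. by rewrite mem_nth // size_children_root. Qed.

Lemma second_child_neq : second_child != first_child.
Proof.
by rewrite /second_child /first_child nth_uniq ?size_children_root ?children_uniq.
Qed.

(** The iterate is the ancestor of [x] at distance 1 from the root. At the root the predecessor
    truncates to 0, but [two_type_field] and [law_constant] treat the root before consulting this
    test. *)
Definition in_first_branch (x : T) : bool :=
  iter (tree_dist x o).-1 (@parent _ T) x == first_child.

Lemma in_first_branch_child x y : x != o -> y \in children x ->
  in_first_branch y = in_first_branch x.
Proof.
rewrite mem_children => xo /andP[yo /eqP yx].
rewrite /in_first_branch (dist_child yo yx) /=.
have : tree_dist x o != 0%N by rewrite dist_eq0.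
by case: (tree_dist x o) => // n _; rewrite iterSr yx.
Qed.

Lemma in_first_branch_root y : y \in children o ->
  in_first_branch y = (y == first_child).
Proof.
rewrite mem_children => /andP[yo /eqP yx].
by rewrite /in_first_branch (dist_child yo yx) dist_root.
Qed.

Lemma prod_const_seq (I : eqType) (s : seq I) (a : Qp) (F : I -> Qp) :
  (forall i, i \in s -> F i = a) -> \prod_(i <- s) F i = a ^+ size s.
Proof.
by move=> Fa; rewrite (eq_big_seq (fun=> a)) // big_const_seq count_predT iter_mulr_1.
Qed.

Variables (A : {set 'I_q}) (b : 'I_q).
Hypothesis A_gt0 : (0 < #|A|)%N.
Hypothesis A_ltq : (#|A| < q)%N.
Hypothesis q_neq2A : q <> (2 * #|A|)%N.
Variable a : Qp.
Hypothesis adom : dom a.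
Let ratio (B : {set 'I_q}) : Qp := 1 - q%:R / #|B|%:R.
Hypothesis exp_a : exp_p a = (1 - q%:R / #|A|%:R) ^+ 3.

(* Logarithms of the laws: exp_p of [fieldA] and [fieldb] is the cube of the
   two-valued function of A and {b}, and exp_p of [field_root] is the product of
   the functions of the four branches, using exp_p J = 1 - q. *)
Definition fieldA (i : 'I_q) : Qp := if i \in A then a else 0.
Definition fieldb (i : 'I_q) : Qp := if i == b then J + J + J else 0.
Definition field_root (i : 'I_q) : Qp := fieldA i + (if i == b then J else 0).

Definition two_type_field (x : T) : 'I_q -> Qp :=
  if x == o then field_root else
  if in_first_branch x then fieldb else fieldA.

Lemma two_type_root : two_type_field o = field_root.
Proof. by rewrite /two_type_field eqxx. Qed.

Lemma two_type_nonroot x : x != o ->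
  two_type_field x = if in_first_branch x then fieldb else fieldA.
Proof. by rewrite /two_type_field => /negPf->. Qed.

Let ratio_b : ratio [set b]%SET = 1 - q%:R.
Proof. by rewrite /ratio cards1 divr1. Qed.

Lemma fieldA_dom i : dom (fieldA i).
Proof. by rewrite /fieldA; case: ifP => _; [exact: adom | exact: padic_exp_dom0]. Qed.

Lemma fieldb_dom i : dom (fieldb i).
Proof.
rewrite /fieldb; case: ifP => _; last exact: padic_exp_dom0.
exact: padic_exp_domD (padic_exp_domD Jdom Jdom) Jdom.
Qed.

Lemma field_root_dom i : dom (field_root i).
Proof.
apply: padic_exp_domD (fieldA_dom i) _.
by case: ifP => _; [exact: Jdom | exact: padic_exp_dom0].
Qed.

Lemma exp_fieldA i : exp_p (fieldA i) = level A i ^+ 3.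
Proof.
rewrite /fieldA /two_level -/(ratio A); case: ifP => _; first exact: exp_a.
by rewrite padic_exp0 expr1n.
Qed.

Lemma exp_J_level i :
  exp_p (if i == b then J else 0) = level [set b]%SET i.
Proof.
rewrite /two_level -/(ratio [set b]%SET) ratio_b finset.in_set1.
by case: ifP => _; [exact: Jq | exact: padic_exp0].
Qed.

Lemma exp_fieldb i : exp_p (fieldb i) = level [set b]%SET i ^+ 3.
Proof.
rewrite -exp_J_level /fieldb; case: ifP => _; last by rewrite padic_exp0 expr1n.
have JJ : dom (J + J) by apply: padic_exp_domD.
by rewrite !padic_expD // 2!exprS expr1 mulrA.
Qed.

Lemma exp_field_root i :
  exp_p (field_root i) = level A i ^+ 3 * level [set b]%SET i.
Proof.
rewrite /field_root padic_expD ?exp_fieldA ?exp_J_level //.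
  exact: fieldA_dom.
by case: ifP => _; [exact: Jdom | exact: padic_exp_dom0].
Qed.

Lemma two_type_field_dom x i : dom (two_type_field x i).
Proof.
rewrite /two_type_field; case: ifP => _; first exact: field_root_dom.
by case: ifP => _; [exact: fieldb_dom | exact: fieldA_dom].
Qed.

Let eigen (B : {set 'I_q}) : Qp := #|B|%:R * (ratio B ^+ 3 - 1).

Lemma bond_level (B : {set 'I_q}) (f : 'I_q -> Qp) i : (0 < #|B|)%N ->
  (forall j, exp_p (f j) = level B j ^+ 3) ->
  \sum_j bond R J j i * exp_p (f j) = eigen B * level B i.
Proof.
move=> B0 fB; rewrite /eigen /ratio -(two_level_law char0 i B0).
by apply: eq_bigr => j _; rewrite fB /bond Jq.
Qed.

Let ratio3_neq1 (B : {set 'I_q}) : ratio B ^+ 6 != 1 -> ratio B ^+ 3 != 1.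
Proof. by apply: contraNneq => B1; rewrite (exprM _ 3 2) B1 expr1n. Qed.

Let ratioA6 : ratio A ^+ 6 != 1.
Proof. exact: two_level_ratio_neq1. Qed.

Let ratiob6 : ratio [set b]%SET ^+ 6 != 1.
Proof. by apply: two_level_ratio_neq1; rewrite ?cards1. Qed.

Let eigen_neq0 (B : {set 'I_q}) : (0 < #|B|)%N -> ratio B ^+ 6 != 1 -> eigen B != 0.
Proof.
by move=> B0 /ratio3_neq1 B3; rewrite mulf_neq0 ?subr_eq0 ?char0.
Qed.

(** One eigenvalue per child: at the root one child of the singleton type and three of type [A],
    elsewhere three children of the type of [x]. *)
Definition law_constant (x : T) : Qp :=
  if x == o then eigen [set b]%SET * eigen A ^+ 3 else
  if in_first_branch x then eigen [set b]%SET ^+ 3 else eigen A ^+ 3.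

Let cardb_gt0 : (0 < #|[set b]%SET|)%N. Proof. by rewrite cards1. Qed.

Lemma law_constant_neq0 x : law_constant x != 0.
Proof.
have eA := eigen_neq0 A_gt0 ratioA6; have eb := eigen_neq0 cardb_gt0 ratiob6.
rewrite /law_constant; case: ifP => _; first by rewrite mulf_neq0 ?expf_neq0.
by case: ifP => _; rewrite expf_neq0.
Qed.

Lemma two_type_law x i :
  \prod_(y <- children x) \sum_j bond R J j i * exp_p (two_type_field y j) =
  law_constant x * exp_p (two_type_field x i).
Proof.
have childo z y : y \in children z -> y != o.
  by rewrite mem_children => /andP[].
have [->|xo] := eqVneq x o.
  (* The root is the only vertex whose children have different types, so its distinguished child is
     split off. *)
  have sE : perm_eq (children o) (first_child :: rem first_child (children o)).
    exact: perm_to_rem first_childP.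
  have E1 : \sum_j bond R J j i * exp_p (two_type_field first_child j) =
      eigen [set b]%SET * level [set b]%SET i.
    rewrite (two_type_nonroot (childo _ _ first_childP)).
    rewrite (in_first_branch_root first_childP) eqxx.
    exact: bond_level cardb_gt0 exp_fieldb.
  have E2 : \prod_(y <- rem first_child (children o))
      \sum_j bond R J j i * exp_p (two_type_field y j) = (eigen A * level A i) ^+ 3.
    rewrite (@prod_const_seq _ _ (eigen A * level A i)) => [|y].
      by rewrite size_rem ?first_childP // size_children_root.
    rewrite (mem_rem_uniq _ (children_uniq _)) => /andP[/= y1 yo].
    rewrite (two_type_nonroot (childo _ _ yo)) (in_first_branch_root yo) (negPf y1).
    exact: bond_level A_gt0 exp_fieldA.
  rewrite (perm_big _ sE) big_cons; apply: etrans (congr2 *%R E1 E2) _.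
  rewrite /law_constant eqxx two_type_root exp_field_root exprMn mulrACA.
  by rewrite [level _ i * _]mulrC.
rewrite /law_constant (negPf xo) (two_type_nonroot xo).
case: ifP => xb.
  rewrite (@prod_const_seq _ _ (eigen [set b]%SET * level [set b]%SET i)).
    by rewrite size_children // exprMn exp_fieldb.
  move=> y yx; rewrite (two_type_nonroot (childo _ _ yx)).
  rewrite (in_first_branch_child xo yx) xb.
  exact: bond_level cardb_gt0 exp_fieldb.
rewrite (@prod_const_seq _ _ (eigen A * level A i)).
  by rewrite size_children // exprMn exp_fieldA.
move=> y yx; rewrite (two_type_nonroot (childo _ _ yx)).
rewrite (in_first_branch_child xo yx) xb.
exact: bond_level A_gt0 exp_fieldA.
Qed.

(* The sum is the left-hand side of the law of A at the spin b. *)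
Lemma two_type_root_sum : \sum_i exp_p (two_type_field o i) != 0.
Proof.
rewrite (eq_bigr (fun j => bond R J j b * exp_p (fieldA j))) => [|j _].
  rewrite (bond_level b A_gt0 exp_fieldA) mulf_neq0 ?eigen_neq0 //.
  have := padic_exp_neq0 (fieldA_dom b); rewrite exp_fieldA.
  by rewrite expf_eq0.
rewrite two_type_root exp_field_root -exp_J_level exp_fieldA mulrC /bond.
by case: ifP => _ //; rewrite padic_exp0.
Qed.

Lemma two_type_gibbs : exists2 mu, gibbs_measures R T q J mu &
  forall n (s : conf q (tball T n)) (C : @cylinder_algebra 3 T q),
    val C = cylinder s -> mu C = gibbs_fin R J two_type_field s.
Proof.
apply: (exists_gibbs_measure b two_type_field_dom).
  exact: (partition_fun_neq0 b Jdom two_type_field_dom two_type_law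
    law_constant_neq0 two_type_root_sum).
exact: (law_compatible b Jdom two_type_field_dom two_type_law law_constant_neq0).
Qed.

Lemma two_type_partition_neq0 n : partition_fun R J two_type_field n != 0.
Proof.
exact: (partition_fun_neq0 b Jdom two_type_field_dom two_type_law
  law_constant_neq0 two_type_root_sum).
Qed.

Lemma exp_two_type_first i :
  exp_p (two_type_field first_child i) = level [set b]%SET i ^+ 3.
Proof.
have := first_childP; rewrite mem_children => /andP[yo _].
by rewrite (two_type_nonroot yo) (in_first_branch_root first_childP) eqxx exp_fieldb.
Qed.

Lemma exp_two_type_second i :
  exp_p (two_type_field second_child i) = level A i ^+ 3.
Proof.
have := second_childP; rewrite mem_children => /andP[yo _].
rewrite (two_type_nonroot yo) (in_first_branch_root second_childP).
by rewrite (negPf second_child_neq) exp_fieldA.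
Qed.

End TwoTypeMeasures.

(** Distinct sets of equal size admit i in A but not in B and j in B but not in A. For this pair the
    proportionality reads x^3 x^3 = 1, which is why sixth roots of unity have to be excluded. *)
Lemma two_level_distinct (K : fieldType) q (A B : {set 'I_q}) :
  #|A| = #|B| -> (1 - q%:R / #|A|%:R : K) ^+ 6 != 1 ->
  (forall i j, two_level K A i ^+ 3 * two_level K B j ^+ 3 =
               two_level K A j ^+ 3 * two_level K B i ^+ 3) -> A = B.
Proof.
move=> AB x6 H; apply: contrapT => /eqP neqAB.
have sub (C D : {set 'I_q}) : #|C| = #|D| -> C != D ->
    exists i, (i \in C) && (i \notin D).
  move=> CD nCD; apply/existsP; rewrite -negb_forall_in.
  apply: contra nCD => /forall_inP CsubD; rewrite eqEcard CD leqnn andbT.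
  by apply/fintype.subsetP.
have [i /andP[iA iB]] := sub A B AB neqAB.
have [j /andP[jB jA]] := sub B A (esym AB) (contra_neq esym neqAB).
have := H i j; rewrite /two_level iA jB (negPf iB) (negPf jA) -AB.
by rewrite -exprD !expr1n mulr1 => /eqP; apply/negP.
Qed.

(** There are q C(q, m) pairs, and q >= 2 together with C(q, m) >= 1 gives q C(q, m) >= C(q, m) +
    1. *)
Lemma leq_card_draws q m : (1 < q)%N -> (1 <= m <= q - 1)%N ->
  (1 + 'C(q, m) <= #|[set u : {set 'I_q} * 'I_q | #|u.1| == m]%SET|)%N.
Proof.
move=> q1 /andP[m1 mq].
have -> : [set u : {set 'I_q} * 'I_q | #|u.1| == m]%SET =
    finset.setX [set A : {set 'I_q} | #|A| == m]%SET [set: 'I_q]%SET.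
  by apply/setP => u; rewrite !inE andbT.
rewrite cardsX card_draws cardsT !card_ord.
have : (0 < 'C(q, m))%N by rewrite bin_gt0; lia.
by nia.
Qed.

Theorem theorem8 (R : realType) (p : nat) (p_pr : prime p)
    (T : cayley_tree 3) (q m : nat) (J : 'Q_[p_pr]) :
  (2 <= q)%N ->
  (1 <= m <= q - 1)%N ->
  padic_exp_dom R J ->
  padic_exp R J = 1 - q%:R ->
  (let norm := padic_norm R (p_pr := p_pr) in
   let x : 'Q_[p_pr] := 1 - q%:R / m%:R in
   [\/ p = 2%N /\ norm q%:R < norm (2 * m%:R),
       p <> 2%N /\ norm q%:R < norm m%:R |
       [/\ p <> 2%N, norm q%:R = norm m%:R &
           padic_eqmod R (x ^+ 2 + x + 1) 0]]) ->
  (`I_(1 + 'C(q, m)) #<= gibbs_measures R T q J)%card.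
Proof.
move=> q2 mq Jdom Jq /= cond.
have [m0 mltq] : (0 < m)%N /\ (m < q)%N by case/andP: mq; lia.
have q_neq2 := exp_nat_neq2 Jdom Jq.
have [x3d q2m] := cubic_ratio m0 (ltnW q2) cond.
have [a ad ax] := padic_exp_surj x3d.
have char0 := padic_nat_neq0 R p_pr.
pose D := [set u : {set 'I_q} * 'I_q | #|u.1| == m]%SET.
pose field (u : {set 'I_q} * 'I_q) : T -> _ := two_type_field J u.1 u.2 a.
have field_dom u x i : padic_exp_dom R (field u x i) by exact: two_type_field_dom.
(* Membership in [D] sits under the existential so that choice yields a function on all pairs; off
   [D] it takes the dummy value 0. *)
have /choice[mu muP] (u : {set 'I_q} * 'I_q) :
    exists mu : @cylinder_algebra 3 T q -> 'Q_[p_pr], u \in D ->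
    [/\ gibbs_measures R T q J mu, forall n, partition_fun R J (field u) n != 0,
      (forall n (s : conf q (tball T n)) (C : @cylinder_algebra 3 T q),
        val C = cylinder s -> mu C = gibbs_fin R J (field u) s) &
      forall i, padic_exp R (field u (second_child T) i) =
                two_level 'Q_[p_pr] u.1 i ^+ 3].
  have [uD|uD] := boolP (u \in D); last by exists (fun=> 0).
  move: uD; rewrite inE => /eqP um.
  have u0 : (0 < #|u.1|)%N by rewrite um.
  have uq : (#|u.1| < q)%N by rewrite um.
  have q2u : q <> (2 * #|u.1|)%N by rewrite um.
  have au : padic_exp R a = (1 - q%:R / #|u.1|%:R) ^+ 3 by rewrite um.
  have [mu mu1 mu2] := two_type_gibbs T Jdom Jq q_neq2 q2 u.2 u0 uq q2u ad au.
  exists mu => _; split=> //.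
    exact: (two_type_partition_neq0 T Jdom Jq q_neq2 q2 u.2 u0 uq q2u ad au).
  exact: (exp_two_type_second T J u.2 au).
have sphere1 y : y \in children (Defs.root T) -> y \in sphere T 1.
  by move=> yo; rewrite (child_in_sphere 0 yo) sphere0 inE.
have mu_inj u v : u \in D -> v \in D -> mu u = mu v -> u = v.
  move=> uD vD uv.
  have [_ uZ muE u2] := muP u uD; have [_ vZ mvE v2] := muP v vD.
  have gE n (s : conf q (tball T n)) :
      gibbs_fin R J (field u) s = gibbs_fin R J (field v) s.
    have sC : cylinder_algebra (cylinder s).
      exists n, [set s]%SET; apply/seteqP; split=> t; rewrite /cylinder /= inE.
        by move=> ->.
      by move/eqP.
    pose C : @cylinder_algebra 3 T q := SigSub (mem_set sC).
    by rewrite -(muE n s C) // -(mvE n s C) // uv.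
  have cross y i j (yo : y \in sphere T 1) :=
    gibbs_fin_determines u.2 Jdom (field_dom u) (field_dom v) uZ vZ i j yo (@gE 1%N).
  move: uD vD; rewrite !inE => /eqP um /eqP vm.
  (* The second child of the root carries the law of the set and the first child that of the
     singleton, so sphere 1 separates both components of the pair. *)
  have E1 : u.1 = v.1.
    apply: (@two_level_distinct 'Q_[p_pr]); first by rewrite um vm.
      by rewrite um; apply: two_level_ratio_neq1.
    move=> i j; have := cross _ i j (sphere1 _ (second_childP T)).
    by rewrite !u2 !v2.
  have E2 : [set u.2]%SET = [set v.2]%SET.
    apply: (@two_level_distinct 'Q_[p_pr]); first by rewrite !cards1.
      by rewrite cards1; apply: two_level_ratio_neq1.
    move=> i j; have := cross _ i j (sphere1 _ (first_childP T)).
    by rewrite !(exp_two_type_first T Jdom Jq).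
  rewrite [u]surjective_pairing [v]surjective_pairing E1; congr pair.
  exact: set1_inj E2.
pose F (i : nat) := mu (nth (finset.set0, Ordinal (ltnW q2)) (enum D) i).
have Dle : (1 + 'C(q, m) <= size (enum D))%N by rewrite -cardE leq_card_draws.
have nthD i : `I_(1 + 'C(q, m)) i ->
    nth (finset.set0, Ordinal (ltnW q2)) (enum D) i \in D.
  by move=> iC; rewrite -mem_enum mem_nth // (leq_trans iC).
have F_inj : {in `I_(1 + 'C(q, m)) &, injective F}.
  move=> i j /set_mem iC /set_mem jC /(mu_inj _ _ (nthD i iC) (nthD j jC)) /eqP.
  rewrite nth_uniq ?enum_uniq //; first by move/eqP.
    exact: leq_trans iC Dle.
  exact: leq_trans jC Dle.
have := inj_card_eq F_inj; rewrite card_eq_le => /andP[_ /card_le_trans]; apply.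
apply: subset_card_le => _ [i iC <-].
by have [] := muP _ (nthD i iC).
Qed.
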